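(* Let $a,k,\gamma,h_0,u_\infty,u_0>0$ be constants, let $\beta,\delta$ be real constants with $\beta\ge\delta$ and $\beta+\delta+1>0$, and put $\alpha=\beta-\delta$. Consider the common system $$\frac{\partial u}{\partial t}=a^2\frac{\partial^2u}{\partial x^2}\ (0<x<s(t),\ t>0),\quad u(s(t),t)=0,\quad -k\frac{\partial u}{\partial x}(s(t),t)=\gamma s^{\beta}(t)\dot s^{\delta}(t)\dot s(t)\ (t>0),\quad s(0)=0. \quad( * )$$ Let $(P_R)$ be the problem $( * )$ together with $k\frac{\partial u}{\partial x}(0,t)=\frac{h_0}{\sqrt t}\left[u(0,t)-u_\infty t^{\alpha/2}\right]$, $t>0$, and let $(P_D)$ be the problem $( * )$ together with $u(0,t)=u_0t^{\alpha/2}$, $t>0$. Let $\xi_R$ be the unique positive solution of $$\frac{ku_\infty}{\gamma2^{\beta+1}a^{\beta+\delta+2}}\cdot\frac{1}{\frac{k}{2ah_0}M(\frac{\alpha}{2}+\frac12,\frac12,z^2)+zM(\frac{\alpha}{2}+1,\frac32,z^2)}=z^{\beta+\delta+1},\quad z>0.$$ If the parameters are related by $$u_0=\frac{u_\infty\,\xi_RM(-\frac{\alpha}{2}+\frac12,\frac32,-\xi_R^2)}{\frac{k}{2ah_0}M(-\frac{\alpha}{2},\frac12,-\xi_R^2)+\xi_RM(-\frac{\alpha}{2}+\frac12,\frac32,-\xi_R^2)},$$ then $(P_R)$ and $(P_D)$ are equivalent, i.e. they have the same similarity type solution $(u,s)$; moreover $\xi_R$ coincides with the unique positive solution $\xi_D$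 of $$\frac{ku_0}{\gamma2^{\beta+1}a^{\beta+\delta+2}}\cdot\frac{1}{zM(\frac{\alpha}{2}+1,\frac32,z^2)}=z^{\beta+\delta+1},\quad z>0.$$
   Context: $M$ is Kummer's confluent hypergeometric function of the first kind, $M(p,q,z)=\sum_{n=0}^{\infty}\frac{(p)_n}{(q)_n}\frac{z^n}{n!}$, with $(p)_0=1$, $(p)_n=p(p+1)\cdots(p+n-1)$. The dot denotes $d/dt$; the unknowns are $u(x,t)$, $0\le x\le s(t)$, $t>0$, and $s(t)$. A solution $(u,s)$ is of similarity type if $u(x,t)=t^{\alpha/2}\varphi(\eta)$, $\eta=\frac{x}{2a\sqrt t}$, with $\varphi$ twice continuously differentiable on $[0,\xi]$, and $s(t)=2\xi a\sqrt t$ for a constant $\xi>0$. Under the stated hypotheses each of the two problems has a unique similarity type solution, of the form $$u=t^{\alpha/2}\left[C_1M\left(-\tfrac{\alpha}{2},\tfrac12,-\eta^2\right)+C_2\eta M\left(-\tfrac{\alpha}{2}+\tfrac12,\tfrac32,-\eta^2\right)\right],\qquad s(t)=2\xi a\sqrt t.$$ For $(P_R)$: $\xi=\xi_R$ and, with $D=\frac{k}{2ah_0}M(-\frac{\alpha}{2},\frac12,-\xi_R^2)+\xi_RM(-\frac{\alpha}{2}+\frac12,\frac32,-\xi_R^2)$, $C_1=u_\infty\xi_RM(-\frac{\alpha}{2}+\frac12,\frac32,-\xi_R^2)/D$, $C_2=-u_\infty M(-\frac{\alpha}{2},\frac12,-\xi_R^2)/D$. For $(P_D)$: $\xi=\xi_D$,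 $C_1=u_0$, $C_2=-\dfrac{u_0M(-\frac{\alpha}{2},\frac12,-\xi_D^2)}{\xi_DM(-\frac{\alpha}{2}+\frac12,\frac32,-\xi_D^2)}$. *)

(* Defs.v *)
From Stdlib Require Import Reals Factorial.
From Coquelicot Require Import Coquelicot.
Open Scope R_scope.

Fixpoint pochhammer (p : R) (n : nat) : R :=
  match n with
  | O => 1
  | S m => pochhammer p m * (p + INR m)
  end.

Definition kummer_M (p q z : R) : R :=
  PSeries (fun n => pochhammer p n / pochhammer q n / INR (fact n)) z.

(* Derivatives of functions that only matter on a closed interval are taken
   relative to that interval (Stdlib's [D_in]); they are the one-sided
   derivatives at the end points. *)
Definition is_C2_on (f : R -> R) (lo hi : R) : Prop :=
  let I := fun y => lo <= y <= hi in
  exists f1 f2 : R -> R, forall y, I y ->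
    D_in f f1 I y /\ D_in f1 f2 I y /\ continue_in f2 I y.

(* u_x(x,t) = l, one-sided at x = 0 and at x = s(t). *)
Definition is_dx (u : R -> R -> R) (s : R -> R) (x t l : R) : Prop :=
  D_in (fun y => u y t) (fun _ => l) (fun y => 0 <= y <= s t) x.

(* The values of [u] and [s] off 0 <= x <= s(t), t > 0 (and t = 0 for [s]) are
   irrelevant; for s continuous and t > 0 the points near (x,t),
   0 < x < s(t), are inside the domain. *)
Definition heat_equation (a : R) (u : R -> R -> R) (s : R -> R) : Prop :=
  exists ux : R -> R -> R, forall x t, 0 < t -> 0 < x < s t ->
    exists ut uxx : R,
      is_derive (fun tau => u x tau) t ut /\
      is_derive (fun y => u y t) x (ux x t) /\
      is_derive (fun y => ux y t) x uxx /\
      ut = a ^ 2 * uxx.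

(* [Rpower] is the real power only for a positive base, so the positivity of
   s and of its derivative, which the powers presuppose, is made explicit.
   It holds for every s of similarity type. *)
Definition stefan_condition (k gamma beta delta : R)
    (u : R -> R -> R) (s : R -> R) : Prop :=
  forall t, 0 < t ->
    exists ux sdot : R,
      0 < s t /\ 0 < sdot /\
      is_dx u s (s t) t ux /\
      is_derive s t sdot /\
      - k * ux = gamma * Rpower (s t) beta * Rpower sdot delta * sdot.

Definition common_system (a k gamma beta delta : R)
    (u : R -> R -> R) (s : R -> R) : Prop :=
  heat_equation a u s /\
  (forall t, 0 < t -> u (s t) t = 0) /\
  stefan_condition k gamma beta delta u s /\
  s 0 = 0.

Definition problem_R (a k gamma beta delta h0 uinf : R)
    (u : R -> R -> R) (s : R -> R) : Prop :=
  common_system a k gamma beta delta u s /\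
  forall t, 0 < t ->
    exists ux : R,
      is_dx u s 0 t ux /\
      k * ux = h0 / sqrt t * (u 0 t - uinf * Rpower t ((beta - delta) / 2)).

Definition problem_D (a k gamma beta delta u0 : R)
    (u : R -> R -> R) (s : R -> R) : Prop :=
  common_system a k gamma beta delta u s /\
  forall t, 0 < t -> u 0 t = u0 * Rpower t ((beta - delta) / 2).

Definition similarity_type (a alpha : R)
    (u : R -> R -> R) (s : R -> R) : Prop :=
  exists (xi : R) (phi : R -> R),
    0 < xi /\
    is_C2_on phi 0 xi /\
    (forall t, 0 < t -> s t = 2 * xi * a * sqrt t) /\
    (forall x t, 0 < t -> 0 <= x <= s t ->
       u x t = Rpower t (alpha / 2) * phi (x / (2 * a * sqrt t))).

Definition similarity_solution
    (P : (R -> R -> R) -> (R -> R) -> Prop) (a alpha : R)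
    (u : R -> R -> R) (s : R -> R) : Prop :=
  P u s /\ similarity_type a alpha u s.

Definition same_on_domain (u1 : R -> R -> R) (s1 : R -> R)
    (u2 : R -> R -> R) (s2 : R -> R) : Prop :=
  (forall t, 0 <= t -> s1 t = s2 t) /\
  (forall x t, 0 < t -> 0 <= x <= s1 t -> u1 x t = u2 x t).

Definition unique_similarity_solution
    (P : (R -> R -> R) -> (R -> R) -> Prop) (a alpha : R)
    (u : R -> R -> R) (s : R -> R) : Prop :=
  similarity_solution P a alpha u s /\
  forall u' s', similarity_solution P a alpha u' s' ->
    same_on_domain u s u' s'.

Definition positive_root_R (a k gamma beta delta h0 uinf z : R) : Prop :=
  let alpha := beta - delta in
  0 < z /\
  k * uinf / (gamma * Rpower 2 (beta + 1) * Rpower a (beta + delta + 2))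
    * (1 / (k / (2 * a * h0) * kummer_M (alpha / 2 + 1 / 2) (1 / 2) (z ^ 2)
            + z * kummer_M (alpha / 2 + 1) (3 / 2) (z ^ 2)))
  = Rpower z (beta + delta + 1).

Definition positive_root_D (a k gamma beta delta u0 z : R) : Prop :=
  let alpha := beta - delta in
  0 < z /\
  k * u0 / (gamma * Rpower 2 (beta + 1) * Rpower a (beta + delta + 2))
    * (1 / (z * kummer_M (alpha / 2 + 1) (3 / 2) (z ^ 2)))
  = Rpower z (beta + delta + 1).

(* Main.v *)
Require Import Defs.
From Stdlib Require Import Reals Factorial Lra Lia.
From Coquelicot Require Import Coquelicot.
Open Scope R_scope.

(** In the similarity variable the heat equation becomes
    [phi'' + 2 y phi' - 2 alpha phi = 0], with basis
    [A(y) = M(-alpha/2, 1/2, -y^2)], [B(y) = y M(-alpha/2 + 1/2, 3/2, -y^2)] of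
    Wronskian [exp(-y^2)].  By Kummer's transformation [A = exp(-y^2) P] and
    [B = exp(-y^2) Q] with [P], [Q] positive and nondecreasing, so a profile
    vanishing at [xi] satisfies [phi 0 = - phi'(xi) Q(xi)] and
    [phi' 0 = phi'(xi) P(xi)]: it is determined by its flux at the free boundary.
    The Robin and Dirichlet conditions fix that flux to
    [- uinf / (c P(xi) + Q(xi))], [c = k / (2 a h0)], and [- u0 / Q(xi)], so the
    Stefan condition is the transcendental equation for [xi], whose left side
    after clearing denominators is strictly increasing in [xi].  The relation
    between [u0] and [uinf] says that the two fluxes agree at [xiR]. *)

(** * Kummer's function *)

Definition kummer_coeff (p q : R) (n : nat) : R :=
  pochhammer p n / pochhammer q n / INR (fact n).

Lemma pochhammer_pos (p : R) (n : nat) : 0 < p -> 0 < pochhammer p n.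
Proof.
  intros Hp; induction n as [|n IH]; simpl; [lra|].
  apply Rmult_lt_0_compat; [exact IH|]. pose proof (pos_INR n); lra.
Qed.

Lemma kummer_coeff_ge0 (p q : R) (n : nat) :
  0 < p -> 0 < q -> 0 <= kummer_coeff p q n.
Proof.
  intros Hp Hq; unfold kummer_coeff.
  apply Rlt_le, Rdiv_lt_0_compat; [apply Rdiv_lt_0_compat|];
    [apply pochhammer_pos .. |]; auto using INR_fact_lt_0.
Qed.

Lemma kummer_coeff_S (p q : R) (n : nat) : 0 < q ->
  kummer_coeff p q (S n) = kummer_coeff p q n * ((p + INR n) / ((q + INR n) * INR (S n))).
Proof.
  intros Hq; unfold kummer_coeff.
  pose proof (pochhammer_pos q n Hq); pose proof (INR_fact_lt_0 n).
  pose proof (pos_INR n); pose proof (lt_0_INR (S n) ltac:(lia)).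
  rewrite fact_simpl, mult_INR. cbn [pochhammer]. field. repeat split; lra.
Qed.

(** Successive coefficients have ratio [(p + n) / ((q + n) (n + 1))], at most [K / (n + 1)] in
    absolute value for [K = |p| / q + 1], because [|p| + n <= K (q + n)]. Comparing with the
    exponential series rather than taking a limit of ratios allows [p] to be zero or negative, where
    coefficients may vanish. *)
Lemma kummer_coeff_bound (p q : R) (n : nat) : 0 < q ->
  Rabs (kummer_coeff p q n) <= (Rabs p / q + 1) ^ n / INR (fact n).
Proof.
  intros Hq. set (K := Rabs p / q + 1).
  assert (HK : 0 < K).
  { assert (0 <= Rabs p / q) by
      (apply Rdiv_le_0_compat; [apply Rabs_pos | exact Hq]). unfold K; lra. }
  induction n as [|n IH].
  - unfold kummer_coeff; simpl. rewrite Rabs_pos_eq; lra.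
  - rewrite kummer_coeff_S by exact Hq.
    pose proof (pos_INR n) as Hn; pose proof (lt_0_INR (S n) ltac:(lia)) as HSn.
    pose proof (INR_fact_lt_0 n) as Hf.
    rewrite Rabs_mult, fact_simpl, mult_INR.
    replace (K ^ S n / (INR (S n) * INR (fact n)))
      with (K ^ n / INR (fact n) * (K / INR (S n))) by (simpl pow; field; lra).
    apply Rmult_le_compat; try apply Rabs_pos; [exact IH|].
    rewrite Rabs_div by (apply Rgt_not_eq, Rmult_lt_0_compat; lra).
    rewrite (Rabs_pos_eq ((q + INR n) * INR (S n)))
      by (apply Rlt_le, Rmult_lt_0_compat; lra).
    replace (K / INR (S n)) with (K * (q + INR n) / ((q + INR n) * INR (S n)))
      by (field; lra).
    apply Rmult_le_compat_r;
      [apply Rlt_le, Rinv_0_lt_compat, Rmult_lt_0_compat; lra|].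
    apply Rle_trans with (1 := Rabs_triang _ _).
    rewrite (Rabs_pos_eq (INR n)) by exact Hn.
    replace (K * (q + INR n)) with (Rabs p + q + Rabs p / q * INR n + INR n)
      by (unfold K; field; lra).
    assert (0 <= Rabs p / q * INR n).
    { apply Rmult_le_pos; [apply Rdiv_le_0_compat; [apply Rabs_pos|lra]|exact Hn]. }
    lra.
Qed.

Lemma CV_radius_kummer (p q : R) : 0 < q -> CV_radius (kummer_coeff p q) = p_infty.
Proof.
  intros Hq.
  assert (H : forall x, 0 <= x -> Rbar_le x (CV_radius (kummer_coeff p q))).
  (* Beyond the radius the terms would not tend to 0, but the exponential series dominates them. *)
  { intros x Hx. rewrite <- (Rabs_pos_eq x Hx). apply Rbar_not_lt_le; intros Hlt.
    apply (CV_disk_outside _ _ Hlt). apply ex_series_lim_0.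
    apply ex_series_Rabs.
    apply (@ex_series_le R_AbsRing R_CompleteNormedModule) with
      (b := fun n => ((Rabs p / q + 1) * x) ^ n / INR (fact n)).
    - intros n. change (Rabs (Rabs (kummer_coeff p q n * x ^ n)) <=
        ((Rabs p / q + 1) * x) ^ n / INR (fact n)).
      rewrite Rabs_Rabsolu, Rabs_mult, (Rabs_pos_eq (x ^ n)) by (apply pow_le; exact Hx).
      rewrite Rpow_mult_distr.
      replace ((Rabs p / q + 1) ^ n * x ^ n / INR (fact n))
        with ((Rabs p / q + 1) ^ n / INR (fact n) * x ^ n)
        by (field; apply INR_fact_neq_0).
      apply Rmult_le_compat_r; [apply pow_le; exact Hx|].
      apply kummer_coeff_bound; exact Hq.
    - exists (exp ((Rabs p / q + 1) * x)).
      eapply is_series_ext; [|apply is_exp_Reals].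
      intros n. unfold scal; simpl; unfold mult; simpl.
      rewrite pow_n_pow; reflexivity. }
  destruct (CV_radius (kummer_coeff p q)) as [r| |]; [|reflexivity|].
  - specialize (H (Rmax 0 (r + 1)) (Rmax_l _ _)); simpl in H.
    pose proof (Rmax_r 0 (r + 1)); lra.
  - destruct (H 0 (Rle_refl 0)).
Qed.

Lemma is_derive_PSeries_entire (c : nat -> R) (z : R) :
  CV_radius c = p_infty -> is_derive (PSeries c) z (PSeries (PS_derive c) z).
Proof. intros H; apply is_derive_PSeries; rewrite H; exact I. Qed.

Lemma ex_pseries_entire (c : nat -> R) (z : R) :
  CV_radius c = p_infty -> ex_pseries c z.
Proof. intros H; apply CV_radius_inside; rewrite H; exact I. Qed.

Definition kummer_M1 (p q : R) : R -> R := PSeries (PS_derive (kummer_coeff p q)).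
Definition kummer_M2 (p q : R) : R -> R :=
  PSeries (PS_derive (PS_derive (kummer_coeff p q))).

Lemma is_derive_kummer_M (p q z : R) : 0 < q ->
  is_derive (kummer_M p q) z (kummer_M1 p q z).
Proof. intros Hq; exact (is_derive_PSeries_entire _ z (CV_radius_kummer p q Hq)). Qed.

Lemma is_derive_kummer_M1 (p q z : R) : 0 < q ->
  is_derive (kummer_M1 p q) z (kummer_M2 p q z).
Proof.
  intros Hq; apply is_derive_PSeries_entire.
  rewrite CV_radius_derive; exact (CV_radius_kummer p q Hq).
Qed.

(** Comparison of coefficients of [z^n]: the recurrence [(n + 1) (q + n) c (n + 1) = (p + n) c n] is
    the differential equation. *)
Lemma kummer_equation (p q z : R) : 0 < q ->
  z * kummer_M2 p q z = (z - q) * kummer_M1 p q z + p * kummer_M p q z.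
Proof.
  intros Hq; pose proof (CV_radius_kummer p q Hq) as HR.
  set (c := kummer_coeff p q).
  change (z * PSeries (PS_derive (PS_derive c)) z =
    (z - q) * PSeries (PS_derive c) z + p * PSeries c z).
  assert (HR1 : CV_radius (PS_derive c) = p_infty) by (rewrite CV_radius_derive; exact HR).
  assert (HR2 : CV_radius (PS_derive (PS_derive c)) = p_infty)
    by (rewrite CV_radius_derive; exact HR1).
  assert (E1 : ex_pseries (PS_incr_1 (PS_derive (PS_derive c))) z)
    by (apply ex_pseries_incr_1, ex_pseries_entire; exact HR2).
  assert (E2 : ex_pseries (PS_scal q (PS_derive c)) z)
    by (apply ex_pseries_scal; [apply Rmult_comm|apply ex_pseries_entire; exact HR1]).
  assert (E3 : ex_pseries (PS_incr_1 (PS_derive c)) z)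
    by (apply ex_pseries_incr_1, ex_pseries_entire; exact HR1).
  assert (E4 : ex_pseries (PS_scal p c) z)
    by (apply ex_pseries_scal; [apply Rmult_comm|apply ex_pseries_entire; exact HR]).
  (* The negative term is moved across, so that each side is a sum of two power series. *)
  enough (E : z * PSeries (PS_derive (PS_derive c)) z + q * PSeries (PS_derive c) z
              = z * PSeries (PS_derive c) z + p * PSeries c z) by lra.
  rewrite <- !PSeries_incr_1, <- !PSeries_scal, <- !PSeries_plus by assumption.
  apply PSeries_ext; intros n.
  change (match n with
          | O => 0
          | S m => INR (S m) * (INR (S (S m)) * c (S (S m)))
          end + q * (INR (S n) * c (S n))
        = match n with O => 0 | S m => INR (S m) * c (S m) end + p * c n).
  destruct n as [|n]; unfold c.
  - rewrite (kummer_coeff_S p q 0 Hq). simpl; field; lra.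
  - rewrite (kummer_coeff_S p q (S n) Hq).
    rewrite !(S_INR (S n)), !S_INR; pose proof (pos_INR n). field; lra.
Qed.

Lemma kummer_M_0 (p q : R) : kummer_M p q 0 = 1.
Proof. unfold kummer_M; rewrite PSeries_0; simpl; field. Qed.

Lemma kummer_M_le (p q x y : R) : 0 < p -> 0 < q -> 0 <= x <= y ->
  kummer_M p q x <= kummer_M p q y.
Proof.
  intros Hp Hq Hxy; apply Series_le.
  - intros n; pose proof (kummer_coeff_ge0 p q n Hp Hq) as H; fold (kummer_coeff p q n).
    split; [apply Rmult_le_pos; [exact H|apply pow_le; lra]|].
    apply Rmult_le_compat_l; [exact H|apply pow_incr; exact Hxy].
  - apply ex_pseries_R, ex_pseries_entire; exact (CV_radius_kummer p q Hq).
Qed.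

Lemma kummer_M_ge1 (p q x : R) : 0 < p -> 0 < q -> 0 <= x -> 1 <= kummer_M p q x.
Proof.
  intros Hp Hq Hx; rewrite <- (kummer_M_0 p q); apply kummer_M_le; lra.
Qed.

(** * The similarity equation *)

(** The similarity equation is the case [c = -2], [d = 2 alpha]; the case [c = 2] is what remains
    when the factor [exp(-y^2)] is split off. *)
Definition hermite_ode (c d : R) (f f1 : R -> R) : Prop :=
  forall y, is_derive f y (f1 y) /\ is_derive f1 y (c * y * f1 y + d * f y).

Ltac rewrite_derives :=
  repeat match goal with
  | H : is_derive _ _ ?l |- context [Derive ?g ?z] =>
      replace (Derive g z) with l by (symmetry; exact (is_derive_unique _ _ _ H))
  end.

(** The sign [sg = -1] serves the basis function [A], and [sg = 1] its positive factor [P]. By the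
    chain rule the second derivative is [2 sg M' + 4 sg z M''] with [z = sg y^2]; Kummer's equation
    eliminates [z M''], and [q = 1/2] is the value for which the bare [M'] term cancels. *)
Lemma kummer_even_ode (sg p : R) : sg ^ 2 = 1 ->
  hermite_ode (2 * sg) (4 * sg * p)
    (fun y => kummer_M p (1 / 2) (sg * y ^ 2))
    (fun y => 2 * sg * y * kummer_M1 p (1 / 2) (sg * y ^ 2)).
Proof.
  intros Hsg y.
  pose proof (is_derive_kummer_M p (1 / 2) (sg * y ^ 2) ltac:(lra)) as H0.
  pose proof (is_derive_kummer_M1 p (1 / 2) (sg * y ^ 2) ltac:(lra)) as H1.
  pose proof (kummer_equation p (1 / 2) (sg * y ^ 2) ltac:(lra)) as HK.
  split; auto_derive; try (eexists; eassumption); try tauto.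
  - rewrite_derives; simpl; ring.
  - rewrite_derives.
    replace (sg * (y * (y * 1))) with (sg * y ^ 2) by ring.
    match goal with |- ?l = _ => replace l with
      (2 * sg * kummer_M1 p (1 / 2) (sg * y ^ 2)
       + 4 * sg * (sg * y ^ 2 * kummer_M2 p (1 / 2) (sg * y ^ 2))) by ring end.
    rewrite HK; field.
Qed.

(** The same elimination for [B] and [Q]: the extra factor [y] produces [6 sg y M'], which cancels
    for [q = 3/2]. *)
Lemma kummer_odd_ode (sg p : R) : sg ^ 2 = 1 ->
  hermite_ode (2 * sg) (4 * sg * p - 2 * sg)
    (fun y => y * kummer_M p (3 / 2) (sg * y ^ 2))
    (fun y => kummer_M p (3 / 2) (sg * y ^ 2)
              + 2 * sg * y ^ 2 * kummer_M1 p (3 / 2) (sg * y ^ 2)).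
Proof.
  intros Hsg y.
  pose proof (is_derive_kummer_M p (3 / 2) (sg * y ^ 2) ltac:(lra)) as H0.
  pose proof (is_derive_kummer_M1 p (3 / 2) (sg * y ^ 2) ltac:(lra)) as H1.
  pose proof (kummer_equation p (3 / 2) (sg * y ^ 2) ltac:(lra)) as HK.
  split; auto_derive; try (eexists; eassumption); try tauto.
  - rewrite_derives; simpl; ring.
  - split; [eexists; eassumption|]. split; [eexists; eassumption|exact I].
  - rewrite_derives.
    replace (sg * (y * (y * 1))) with (sg * y ^ 2) by ring.
    match goal with |- ?l = _ => replace l with
      (6 * sg * y * kummer_M1 p (3 / 2) (sg * y ^ 2)
       + 4 * sg * y * (sg * y ^ 2 * kummer_M2 p (3 / 2) (sg * y ^ 2))) by ring end.
    rewrite HK; field.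
Qed.

(** This carries the solutions in [+y^2] to solutions of the similarity equation, as Kummer's
    transformation requires. *)
Lemma hermite_ode_gauss (d : R) (f f1 : R -> R) :
  hermite_ode 2 (d + 2) f f1 ->
  hermite_ode (-2) d (fun y => exp (- y ^ 2) * f y)
    (fun y => exp (- y ^ 2) * (f1 y - 2 * y * f y)).
Proof.
  intros H y; destruct (H y) as [H0 H1].
  split; auto_derive; try (repeat split; eexists; eassumption);
    rewrite_derives;
    replace (- (y * (y * 1))) with (- y ^ 2) by ring; ring.
Qed.

(** The normalization at 0 makes the coordinates of a solution [f] in this basis equal to [f 0] and
    [f1 0]. *)
Record fundamental_pair (d : R) (A A1 B B1 : R -> R) : Prop := {
  fp_A : hermite_ode (-2) d A A1;
  fp_B : hermite_ode (-2) d B B1;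
  fp_A0 : A 0 = 1; fp_A10 : A1 0 = 0;
  fp_B0 : B 0 = 0; fp_B10 : B1 0 = 1 }.

(** The derivative is asked for in the open interval only, since that is where the heat equation
    gives information on a profile. *)
Lemma derive0_const (F : R -> R) (xi : R) :
  (forall y, 0 <= y <= xi -> continuity_pt F y) ->
  (forall y, 0 < y < xi -> is_derive F y 0) ->
  forall y, 0 <= y <= xi -> F y = F 0.
Proof.
  intros Hc Hd y Hy.
  destruct (MVT_gen F 0 y (fun _ => 0)) as [c [_ E]].
  - rewrite Rmin_left, Rmax_right by lra. intros x Hx; apply Hd; lra.
  - rewrite Rmin_left, Rmax_right by lra. intros x Hx; apply Hc; lra.
  - lra.
Qed.

Lemma is_derive_continuity_pt (f : R -> R) (y l : R) :
  is_derive f y l -> continuity_pt f y.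
Proof.
  intros H; apply continuity_pt_filterlim.
  apply (@ex_derive_continuous R_AbsRing R_NormedModule); exists l; exact H.
Qed.

(** Abel's identity: the Wronskian satisfies [W' = -2 y W], so [W exp(y^2)] keeps its value at 0. *)
Lemma wronskian (d : R) (A A1 B B1 : R -> R) : fundamental_pair d A A1 B B1 ->
  forall y, 0 <= y -> (A y * B1 y - A1 y * B y) * exp (y ^ 2) = 1.
Proof.
  intros [HA HB A0 A10 B0 B10] y Hy.
  set (F := fun y => (A y * B1 y - A1 y * B y) * exp (y ^ 2)).
  assert (HF : forall z, is_derive F z 0).
  { intros z; destruct (HA z) as [a0 a1], (HB z) as [b0 b1].
    unfold F; auto_derive; [repeat split; eexists; eassumption|].
    rewrite_derives. ring. }
  change (F y = 1). transitivity (F 0).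
  - apply (derive0_const F y); [|intros; apply HF|lra].
    intros z _; exact (is_derive_continuity_pt _ _ _ (HF z)).
  - unfold F; rewrite A0, A10, B0, B10.
    replace (0 ^ 2) with 0 by ring; rewrite exp_0; ring.
Qed.

(* Variation of constants: the Wronskians of [f] with [A] and with [B], divided
   by that of [A] and [B], are constant. *)
Lemma fundamental_span (d xi : R) (A A1 B B1 f f1 : R -> R) :
  fundamental_pair d A A1 B B1 ->
  (forall y, 0 <= y <= xi -> continuity_pt f y) ->
  (forall y, 0 <= y <= xi -> continuity_pt f1 y) ->
  (forall y, 0 < y < xi ->
     is_derive f y (f1 y) /\ is_derive f1 y (-2 * y * f1 y + d * f y)) ->
  forall y, 0 <= y <= xi ->
    f y = f 0 * A y + f1 0 * B y /\ f1 y = f 0 * A1 y + f1 0 * B1 y.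
Proof.
  intros HP Cf Cf1 Hf y Hy.
  pose proof (wronskian _ _ _ _ _ HP y (proj1 Hy)) as HW.
  destruct HP as [HA HB A0 A10 B0 B10].
  assert (Cexp : forall z, continuity_pt (fun z => exp (z ^ 2)) z).
  { intros z; apply (is_derive_continuity_pt _ z (2 * z * exp (z ^ 2))).
    auto_derive; [trivial|]. replace (z * (z * 1)) with (z ^ 2) by ring; ring. }
  assert (CA : forall z, continuity_pt A z)
    by (intros z; exact (is_derive_continuity_pt _ _ _ (proj1 (HA z)))).
  assert (CA1 : forall z, continuity_pt A1 z)
    by (intros z; exact (is_derive_continuity_pt _ _ _ (proj2 (HA z)))).
  assert (CB : forall z, continuity_pt B z)
    by (intros z; exact (is_derive_continuity_pt _ _ _ (proj1 (HB z)))).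
  assert (CB1 : forall z, continuity_pt B1 z)
    by (intros z; exact (is_derive_continuity_pt _ _ _ (proj2 (HB z)))).
  assert (E1 : (f y * B1 y - f1 y * B y) * exp (y ^ 2) = f 0).
  { rewrite (derive0_const (fun y => (f y * B1 y - f1 y * B y) * exp (y ^ 2)) xi);
      [| | |exact Hy].
    - rewrite B0, B10; replace (0 ^ 2) with 0 by ring; rewrite exp_0; ring.
    - intros z Hz.
      apply (continuity_pt_mult (fun z => f z * B1 z - f1 z * B z)
        (fun z => exp (z ^ 2))); [|apply Cexp].
      apply (continuity_pt_minus (fun z => f z * B1 z) (fun z => f1 z * B z));
        apply continuity_pt_mult; auto.
    - intros z Hz; destruct (Hf z Hz) as [g0 g1], (HB z) as [b0 b1].
      auto_derive; [repeat split; eexists; eassumption|].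
      rewrite_derives. ring. }
  assert (E2 : (A y * f1 y - A1 y * f y) * exp (y ^ 2) = f1 0).
  { rewrite (derive0_const (fun y => (A y * f1 y - A1 y * f y) * exp (y ^ 2)) xi);
      [| | |exact Hy].
    - rewrite A0, A10; replace (0 ^ 2) with 0 by ring; rewrite exp_0; ring.
    - intros z Hz.
      apply (continuity_pt_mult (fun z => A z * f1 z - A1 z * f z)
        (fun z => exp (z ^ 2))); [|apply Cexp].
      apply (continuity_pt_minus (fun z => A z * f1 z) (fun z => A1 z * f z));
        apply continuity_pt_mult; auto.
    - intros z Hz; destruct (Hf z Hz) as [g0 g1], (HA z) as [b0 b1].
      auto_derive; [repeat split; eexists; eassumption|].
      rewrite_derives. ring. }
  (* Cramer's rule: after this substitution each right-hand side is [f y], respectively [f1 y],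
     times the normalized Wronskian of [A] and [B]. *)
  rewrite <- E1, <- E2; split.
  - transitivity (f y * ((A y * B1 y - A1 y * B y) * exp (y ^ 2)));
      [rewrite HW|]; ring.
  - transitivity (f1 y * ((A y * B1 y - A1 y * B y) * exp (y ^ 2)));
      [rewrite HW|]; ring.
Qed.

Lemma hermite_ode_span (d : R) (A A1 B B1 f f1 : R -> R) :
  fundamental_pair d A A1 B B1 -> hermite_ode (-2) d f f1 ->
  forall y, 0 <= y -> f y = f 0 * A y + f1 0 * B y.
Proof.
  intros HP H y Hy; apply (fundamental_span d y A A1 B B1 f f1 HP); [| | |lra].
  - intros z _; exact (is_derive_continuity_pt _ _ _ (proj1 (H z))).
  - intros z _; exact (is_derive_continuity_pt _ _ _ (proj2 (H z))).
  - intros z _; exact (H z).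
Qed.

(** * Kummer's basis and Kummer's transformation *)

Definition kummer_A (alpha y : R) : R := kummer_M (- alpha / 2) (1 / 2) (- y ^ 2).
Definition kummer_B (alpha y : R) : R :=
  y * kummer_M (- alpha / 2 + 1 / 2) (3 / 2) (- y ^ 2).

Lemma hermite_ode_ext (c d c' d' : R) (f g f1 : R -> R) :
  c = c' -> d = d' -> (forall y, f y = g y) ->
  hermite_ode c d f f1 -> hermite_ode c' d' g f1.
Proof.
  intros <- <- E H y; destruct (H y) as [H0 H1]; split.
  - exact (is_derive_ext _ _ _ _ E H0).
  - rewrite <- E; exact H1.
Qed.

Lemma kummer_fundamental (alpha : R) :
  exists A1 B1, fundamental_pair (2 * alpha) (kummer_A alpha) A1 (kummer_B alpha) B1.
Proof.
  pose proof (kummer_even_ode (-1) (- alpha / 2) ltac:(ring)) as HA.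
  pose proof (kummer_odd_ode (-1) (- alpha / 2 + 1 / 2) ltac:(ring)) as HB.
  (* The derivatives [A1] and [B1] are read off by unification from [HA] and [HB], taken at
     [sg = -1]. *)
  eexists; eexists; constructor.
  - refine (hermite_ode_ext _ _ _ _ _ _ _ _ _ _ HA); [ring|field|].
    intros y; unfold kummer_A; f_equal; ring.
  - refine (hermite_ode_ext _ _ _ _ _ _ _ _ _ _ HB); [ring|field|].
    intros y; unfold kummer_B; do 2 f_equal; ring.
  - unfold kummer_A; replace (- 0 ^ 2) with 0 by ring; apply kummer_M_0.
  - simpl; ring.
  - unfold kummer_B; ring.
  - simpl. replace (-1 * (0 * (0 * 1))) with 0 by ring; rewrite kummer_M_0; ring.
Qed.

(* Kummer's transformation, read off from uniqueness for the Hermite equation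
   instead of from a Cauchy product. *)
Lemma kummer_A_transform (alpha y : R) : 0 <= y ->
  kummer_A alpha y = exp (- y ^ 2) * kummer_M (alpha / 2 + 1 / 2) (1 / 2) (y ^ 2).
Proof.
  intros Hy; destruct (kummer_fundamental alpha) as (A1 & B1 & HP).
  pose proof (kummer_even_ode 1 (alpha / 2 + 1 / 2) ltac:(ring)) as H.
  apply (hermite_ode_ext _ _ 2 (2 * alpha + 2) _
    (fun y => kummer_M (alpha / 2 + 1 / 2) (1 / 2) (y ^ 2))) in H;
    [|ring|field|intros; f_equal; ring].
  apply hermite_ode_gauss in H.
  rewrite (hermite_ode_span _ _ _ _ _ _ _ HP H y Hy); cbv beta.
  replace (0 ^ 2) with 0 by ring.
  rewrite kummer_M_0, Ropp_0, exp_0; ring.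
Qed.

(** The odd counterpart: the right-hand side solves the similarity equation with value 0 and slope 1
    at 0. *)
Lemma kummer_B_transform (alpha y : R) : 0 <= y ->
  kummer_B alpha y = exp (- y ^ 2) * (y * kummer_M (alpha / 2 + 1) (3 / 2) (y ^ 2)).
Proof.
  intros Hy; destruct (kummer_fundamental alpha) as (A1 & B1 & HP).
  pose proof (kummer_odd_ode 1 (alpha / 2 + 1) ltac:(ring)) as H.
  apply (hermite_ode_ext _ _ 2 (2 * alpha + 2) _
    (fun y => y * kummer_M (alpha / 2 + 1) (3 / 2) (y ^ 2))) in H;
    [|ring|field|intros; do 2 f_equal; ring].
  apply hermite_ode_gauss in H.
  rewrite (hermite_ode_span _ _ _ _ _ _ _ HP H y Hy); cbv beta.
  replace (0 ^ 2) with 0 by ring. replace (1 * 0) with 0 by ring.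
  rewrite kummer_M_0, Ropp_0, exp_0; ring.
Qed.

(** * Derivatives relative to an interval *)

Lemma D_in_interior (f f1 : R -> R) (lo hi y : R) :
  lo < y < hi -> D_in f f1 (fun z => lo <= z <= hi) y -> is_derive f y (f1 y).
Proof.
  intros Hy H; apply is_derive_Reals, derivable_pt_lim_D_in.
  intros eps He; destruct (H eps He) as [al [Hal Hl]].
  exists (Rmin al (Rmin (y - lo) (hi - y))); split.
  - repeat apply Rmin_glb_lt; lra.
  - simpl; intros z [[_ Hz] Hd]; apply Hl; split; [split; [|exact Hz]|].
    + unfold Rdist in Hd.
      pose proof (Rmin_r al (Rmin (y - lo) (hi - y))).
      pose proof (Rmin_l (y - lo) (hi - y)); pose proof (Rmin_r (y - lo) (hi - y)).
      apply Rabs_def2 in Hd; lra.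
    + eapply Rlt_le_trans; [exact Hd|apply Rmin_l].
Qed.

Lemma is_derive_D_in (f f1 : R -> R) (D : R -> Prop) (y : R) :
  is_derive f y (f1 y) -> D_in f f1 D y.
Proof.
  intros H; apply is_derive_Reals, derivable_pt_lim_D_in in H.
  intros eps He; destruct (H eps He) as [al [Hal Hl]].
  exists al; split; [exact Hal|].
  intros z [[_ Hz] Hd]; apply Hl; split; [split; [exact I|exact Hz]|exact Hd].
Qed.

(** [D_in] sees the function only on [D] and the derivative only at [x]; this permits the constant
    derivative function in [is_dx] and the passage from [u] to its similarity formula. *)
Lemma D_in_congr (f g d d' : R -> R) (D : R -> Prop) (x : R) :
  D x -> (forall y, D y -> f y = g y) -> d x = d' x ->
  D_in f d D x -> D_in g d' D x.
Proof.
  intros Hx E Ed H eps He; destruct (H eps He) as [al [Hal Hl]].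
  exists al; split; [exact Hal|].
  intros z Hz; pose proof (Hl z Hz) as Hz'.
  rewrite <- (E z (proj1 (proj1 Hz))), <- (E x Hx), <- Ed; exact Hz'.
Qed.

Lemma D_in_unique (f d d' : R -> R) (lo hi x : R) :
  lo < hi -> lo <= x <= hi ->
  D_in f d (fun z => lo <= z <= hi) x -> D_in f d' (fun z => lo <= z <= hi) x ->
  d x = d' x.
Proof.
  intros Hlh Hx; apply single_limit; intros al Hal.
  (* Uniqueness of limits needs [x] to be an accumulation point; the nearby point is taken towards
     the farther end of the interval, so as not to leave it. *)
  destruct (Rle_lt_dec x ((lo + hi) / 2)) as [Hl|Hl].
  - pose proof (Rmin_l (al / 2) ((hi - lo) / 2)).
    pose proof (Rmin_r (al / 2) ((hi - lo) / 2)).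
    assert (0 < Rmin (al / 2) ((hi - lo) / 2)) by (apply Rmin_glb_lt; lra).
    exists (x + Rmin (al / 2) ((hi - lo) / 2)); unfold D_x, Rdist.
    split; [lra|]. rewrite Rabs_pos_eq; lra.
  - pose proof (Rmin_l (al / 2) ((hi - lo) / 2)).
    pose proof (Rmin_r (al / 2) ((hi - lo) / 2)).
    assert (0 < Rmin (al / 2) ((hi - lo) / 2)) by (apply Rmin_glb_lt; lra).
    exists (x - Rmin (al / 2) ((hi - lo) / 2)); unfold D_x, Rdist.
    split; [lra|]. rewrite Rabs_left; lra.
Qed.

Lemma D_in_scale (f f1 : R -> R) (xi c m x : R) : 0 < c ->
  D_in f f1 (fun z => 0 <= z <= xi) (x / c) ->
  D_in (fun y => m * f (y / c)) (fun y => m * f1 (y / c) / c)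
    (fun y => 0 <= y <= xi * c) x.
Proof.
  intros Hc H eps He.
  assert (HK : 0 < Rabs (m / c) + 1) by (pose proof (Rabs_pos (m / c)); lra).
  (* Rescaling multiplies the error of the difference quotient by [m / c]; adding 1 keeps the
     divisor positive when [m = 0]. *)
  destruct (H (eps / (Rabs (m / c) + 1))) as [al [Hal Hl]].
  { apply Rdiv_lt_0_compat; assumption. }
  exists (al * c); split; [apply Rmult_lt_0_compat; assumption|].
  simpl; unfold Rdist; intros z [[Hz Hzx] Hd].
  assert (Hz' : 0 <= z / c <= xi).
  { split; [apply Rdiv_le_0_compat; lra|]. apply Rle_div_l; lra. }
  assert (Hzx' : x / c <> z / c).
  { intros E; apply Hzx; apply Rmult_eq_reg_r with (/ c); [exact E|].
    apply Rinv_neq_0_compat; lra. }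
  assert (Hd' : Rabs (z / c - x / c) < al).
  { replace (z / c - x / c) with ((z - x) / c) by (field; lra).
    rewrite Rabs_div, (Rabs_pos_eq c) by lra. apply Rlt_div_l; lra. }
  specialize (Hl (z / c) (conj (conj Hz' Hzx') Hd')); simpl in Hl; unfold Rdist in Hl.
  replace ((m * f (z / c) - m * f (x / c)) / (z - x) - m * f1 (x / c) / c)
    with (m / c * ((f (z / c) - f (x / c)) / (z / c - x / c) - f1 (x / c)))
    by (field; repeat split; lra).
  rewrite Rabs_mult.
  apply Rlt_div_r in Hl; [|exact HK].
  eapply Rle_lt_trans; [|exact Hl].
  rewrite Rmult_comm; apply Rmult_le_compat_l; [apply Rabs_pos|lra].
Qed.

(** Nearest-point projection onto [[0, xi]]. Composing with it extends a function continuous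
    relative to the interval to one continuous on the whole line. *)
Definition clamp (xi y : R) : R := Rmax 0 (Rmin y xi).

Lemma clamp_id (xi y : R) : 0 <= y <= xi -> clamp xi y = y.
Proof. intros H; unfold clamp; rewrite Rmin_left, Rmax_right; lra. Qed.

Lemma clamp_in (xi y : R) : 0 <= xi -> 0 <= clamp xi y <= xi.
Proof.
  intros H; unfold clamp; split; [apply Rmax_l|].
  apply Rmax_lub; [exact H|apply Rmin_r].
Qed.

Lemma clamp_lipschitz (xi y z : R) : Rabs (clamp xi z - clamp xi y) <= Rabs (z - y).
Proof.
  unfold clamp, Rmax, Rmin; repeat destruct Rle_dec; unfold Rabs;
    repeat destruct Rcase_abs; lra.
Qed.

Lemma continue_in_clamp (f : R -> R) (xi : R) : 0 <= xi ->
  (forall y, 0 <= y <= xi -> continue_in f (fun z => 0 <= z <= xi) y) ->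
  forall y, continuity_pt (fun z => f (clamp xi z)) y.
Proof.
  intros Hxi H y eps He.
  destruct (H (clamp xi y) (clamp_in xi y Hxi) eps He) as [al [Hal Hl]].
  exists al; split; [exact Hal|]. simpl; unfold Rdist in *.
  (* The limit in [continue_in] excludes the base point itself, and [clamp] may send distinct points
     to it. *)
  intros z [_ Hd]; destruct (Req_dec (clamp xi y) (clamp xi z)) as [E|N].
  - rewrite E, Rminus_diag_eq, Rabs_R0 by reflexivity; exact He.
  - apply (Hl (clamp xi z)); split; [split; [apply clamp_in; exact Hxi|exact N]|].
    simpl; unfold Rdist; eapply Rle_lt_trans; [apply clamp_lipschitz|exact Hd].
Qed.

Lemma locally_open_interval (lo hi y : R) :
  lo < y < hi -> locally y (fun z => lo < z < hi).
Proof.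
  intros H; apply filter_and; [apply (open_gt lo)|apply (open_lt hi)]; apply H.
Qed.

(** [fundamental_span] is applied to [f] and [f1] composed with [clamp]: these are continuous
    everywhere, agree with [f] and [f1] on [[0, xi]], and have the same derivatives in the
    interior. *)
Lemma fundamental_span_D_in (d xi : R) (A A1 B B1 f f1 f2 : R -> R) :
  0 < xi -> fundamental_pair d A A1 B B1 ->
  (forall y, 0 <= y <= xi -> D_in f f1 (fun z => 0 <= z <= xi) y /\
     D_in f1 f2 (fun z => 0 <= z <= xi) y) ->
  (forall y, 0 < y < xi -> f2 y = -2 * y * f1 y + d * f y) ->
  forall y, 0 <= y <= xi ->
    f y = f 0 * A y + f1 0 * B y /\ f1 y = f 0 * A1 y + f1 0 * B1 y.
Proof.
  intros Hxi HP HD Ho y Hy.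
  assert (Hloc : forall (g g1 : R -> R) (z : R), 0 < z < xi ->
    D_in g g1 (fun z => 0 <= z <= xi) z ->
    is_derive (fun z => g (clamp xi z)) z (g1 z)).
  { intros g g1 z Hz Hg; apply is_derive_ext_loc with g.
    - apply (filter_imp (fun w => 0 < w < xi)); [|exact (locally_open_interval 0 xi z Hz)].
      intros w Hw; rewrite clamp_id by lra; reflexivity.
    - exact (D_in_interior g g1 0 xi z Hz Hg). }
  pose proof (fundamental_span d xi A A1 B B1
    (fun z => f (clamp xi z)) (fun z => f1 (clamp xi z)) HP) as H.
  cbv beta in H. rewrite !(clamp_id xi 0) in H by lra.
  (* Only the arguments of [f] and [f1] are clamped, not those of the basis functions. *)
  rewrite <- (clamp_id xi y Hy) at 1 4. apply H; [| | |exact Hy].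
  - intros z _; apply continue_in_clamp; [lra|].
    intros w Hw; exact (cont_deriv _ _ _ _ (proj1 (HD w Hw))).
  - intros z _; apply continue_in_clamp; [lra|].
    intros w Hw; exact (cont_deriv _ _ _ _ (proj2 (HD w Hw))).
  - intros z Hz; rewrite (clamp_id xi z) by lra.
    destruct (HD z ltac:(lra)) as [D1 D2]; split; [exact (Hloc _ _ z Hz D1)|].
    rewrite <- Ho by exact Hz; exact (Hloc _ _ z Hz D2).
Qed.

(** * Reduction to the profile *)

(** The body of [is_C2_on] on [[0, xi]] with its witnesses named, so that the boundary conditions
    can refer to [f1]. *)
Definition C2_with (f f1 f2 : R -> R) (xi : R) : Prop :=
  forall y, 0 <= y <= xi ->
    D_in f f1 (fun z => 0 <= z <= xi) y /\
    D_in f1 f2 (fun z => 0 <= z <= xi) y /\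
    continue_in f2 (fun z => 0 <= z <= xi) y.

Definition similarity_form (a alpha xi : R) (phi : R -> R)
    (u : R -> R -> R) (s : R -> R) : Prop :=
  (forall t, 0 < t -> s t = 2 * xi * a * sqrt t) /\
  (forall x t, 0 < t -> 0 <= x <= s t ->
     u x t = Rpower t (alpha / 2) * phi (x / (2 * a * sqrt t))).

Lemma Rpower_base_1 (y : R) : Rpower 1 y = 1.
Proof. unfold Rpower; rewrite ln_1, Rmult_0_r; apply exp_0. Qed.

Lemma similarity_is_dx (a alpha xi : R) (phi f1 : R -> R) (u : R -> R -> R)
    (s : R -> R) (x t : R) :
  0 < a -> 0 < t -> similarity_form a alpha xi phi u s -> 0 <= x <= s t ->
  D_in phi f1 (fun z => 0 <= z <= xi) (x / (2 * a * sqrt t)) ->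
  is_dx u s x t
    (Rpower t (alpha / 2) * f1 (x / (2 * a * sqrt t)) / (2 * a * sqrt t)).
Proof.
  intros Ha Ht [Hs Hu] Hx HD.
  pose proof (sqrt_lt_R0 t Ht) as Hst.
  assert (Hc : 0 < 2 * a * sqrt t) by (apply Rmult_lt_0_compat; lra).
  pose proof (D_in_scale phi f1 xi (2 * a * sqrt t) (Rpower t (alpha / 2)) x Hc HD) as H.
  assert (E : xi * (2 * a * sqrt t) = s t) by (rewrite Hs by exact Ht; ring).
  rewrite E in H; unfold is_dx.
  refine (D_in_congr _ _ _ _ _ x Hx _ _ H); [|reflexivity].
  intros y Hy; symmetry; apply Hu; assumption.
Qed.

Lemma is_dx_unique (u : R -> R -> R) (s : R -> R) (x t l l' : R) :
  0 < s t -> 0 <= x <= s t -> is_dx u s x t l -> is_dx u s x t l' -> l = l'.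
Proof.
  intros Hs Hx H H'; exact (D_in_unique _ _ _ 0 (s t) x Hs Hx H H').
Qed.

(** * The heat equation in the similarity variable *)

Lemma similarity_locally_t (a xi x t : R) :
  0 < a -> 0 < xi -> 0 < t -> 0 < x < 2 * xi * a * sqrt t ->
  locally t (fun tau => 0 < tau /\ x < 2 * xi * a * sqrt tau).
Proof.
  intros Ha Hxi Ht Hx.
  assert (Hc : 0 < 2 * xi * a) by (repeat apply Rmult_lt_0_compat; lra).
  apply filter_and; [exact (open_gt 0 t Ht)|].
  (* The front reaches [x] at time [r^2], so [x] lies behind the front at all later times. *)
  set (r := x / (2 * xi * a)).
  assert (Hr : 0 < r) by (apply Rdiv_lt_0_compat; lra).
  apply (filter_imp (fun tau => r ^ 2 < tau)).
  - intros tau Htau. rewrite Rmult_comm; apply Rlt_div_l; [exact Hc|fold r].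
    rewrite <- (sqrt_pow2 r) by lra. apply sqrt_lt_1_alt; split; [apply pow2_ge_0|exact Htau].
  - apply (open_gt (r ^ 2)). rewrite <- (pow2_sqrt t) by lra.
    assert (r < sqrt t) by (apply Rlt_div_l; [exact Hc|rewrite Rmult_comm; lra]).
    simpl; rewrite !Rmult_1_r; apply Rmult_le_0_lt_compat; lra.
Qed.

Section Similarity.

Context (a alpha xi : R) (phi f1 f2 : R -> R) (u : R -> R -> R) (s : R -> R).
Context (Ha : 0 < a) (Hxi : 0 < xi)
  (Hphi : forall y, 0 < y < xi -> is_derive phi y (f1 y) /\ is_derive f1 y (f2 y))
  (Hsim : similarity_form a alpha xi phi u s).

Let form_s : forall t, 0 < t -> s t = 2 * xi * a * sqrt t := proj1 Hsim.
Let form_u := proj2 Hsim.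

Lemma similarity_eta (x t : R) : 0 < t -> 0 < x < s t ->
  0 < x / (2 * a * sqrt t) < xi.
Proof.
  intros Ht Hx; rewrite form_s in Hx by exact Ht.
  pose proof (sqrt_lt_R0 t Ht).
  assert (0 < 2 * a * sqrt t) by (apply Rmult_lt_0_compat; lra).
  split; [apply Rdiv_lt_0_compat; lra|]. apply Rlt_div_l; [assumption|].
  replace (xi * (2 * a * sqrt t)) with (2 * xi * a * sqrt t) by ring; lra.
Qed.

(** Product and chain rule, with [d eta / dt = - eta / (2 t)]. *)
Lemma similarity_is_derive_t (x t : R) : 0 < t -> 0 < x < s t ->
  let eta := x / (2 * a * sqrt t) in
  is_derive (fun tau => u x tau) t
    (Rpower t (alpha / 2) / (2 * t) * (alpha * phi eta - eta * f1 eta)).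
Proof.
  intros Ht Hx eta; pose proof (similarity_eta x t Ht Hx) as He.
  pose proof (sqrt_lt_R0 t Ht) as Hst.
  apply is_derive_ext_loc with
    (fun tau => Rpower tau (alpha / 2) * phi (x / (2 * a * sqrt tau))).
  - rewrite form_s in Hx by exact Ht.
    apply (filter_imp (fun tau => 0 < tau /\ x < 2 * xi * a * sqrt tau));
      [|apply similarity_locally_t; assumption].
    intros tau [H1 H2]; symmetry; apply form_u; [exact H1|].
    rewrite form_s by exact H1; lra.
  - destruct (Hphi _ He) as [H0 _]; fold eta in H0.
    unfold Rpower; auto_derive.
    + repeat split; try lra; try (apply Rgt_not_eq; nra).
      eexists; exact H0.
    + fold eta; rewrite_derives.
      change (x * / (2 * a * sqrt t)) with eta.
      assert (Et : t = sqrt t * sqrt t) by (rewrite sqrt_sqrt; lra).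
      set (p := exp (alpha / 2 * ln t)); set (r := sqrt t) in *.
      generalize (f1 eta) (phi eta); intros v w; unfold eta; clearbody p r.
      rewrite Et; field; lra.
Qed.

Lemma similarity_is_derive_x (x t : R) : 0 < t -> 0 < x < s t ->
  is_derive (fun y => u y t) x
    (Rpower t (alpha / 2) * f1 (x / (2 * a * sqrt t)) / (2 * a * sqrt t)).
Proof.
  intros Ht Hx; pose proof (similarity_eta x t Ht Hx) as He.
  pose proof (sqrt_lt_R0 t Ht) as Hst.
  apply is_derive_ext_loc with
    (fun y => Rpower t (alpha / 2) * phi (y / (2 * a * sqrt t))).
  - apply (filter_imp (fun y => 0 < y < s t)); [|apply locally_open_interval; exact Hx].
    intros y Hy; symmetry; apply form_u; lra.
  - destruct (Hphi _ He) as [H0 _].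
    auto_derive; [eexists; exact H0|]. rewrite_derives. field; lra.
Qed.

Lemma similarity_is_derive_xx (x t : R) : 0 < t -> 0 < x < s t ->
  is_derive (fun y => Rpower t (alpha / 2) * f1 (y / (2 * a * sqrt t)) / (2 * a * sqrt t))
    x (Rpower t (alpha / 2) / (4 * a ^ 2 * t) * f2 (x / (2 * a * sqrt t))).
Proof.
  intros Ht Hx; pose proof (similarity_eta x t Ht Hx) as He.
  pose proof (sqrt_lt_R0 t Ht) as Hst.
  destruct (Hphi _ He) as [_ H1].
  auto_derive; [eexists; exact H1|]. rewrite_derives.
  change (x * / (2 * a * sqrt t)) with (x / (2 * a * sqrt t)).
  assert (Et : t = sqrt t * sqrt t) by (rewrite sqrt_sqrt; lra).
  generalize (f2 (x / (2 * a * sqrt t))) (Rpower t (alpha / 2)); intros v w.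
  set (r := sqrt t) in *; clearbody r; rewrite Et; field; lra.
Qed.

(** Both [u_t] and [a^2 u_xx] carry the factor [t^(alpha/2) / t]; dividing by it leaves
    [(alpha phi - eta phi') / 2 = phi'' / 4]. For the forward direction the time [t = 1] suffices,
    with [x = 2 a y]. *)
Lemma similarity_heat :
  heat_equation a u s <->
  (forall y, 0 < y < xi -> f2 y = -2 * y * f1 y + 2 * alpha * phi y).
Proof.
  split.
  - intros [ux Hux] y Hy.
    assert (Hs1 : s 1 = 2 * xi * a) by (rewrite form_s, sqrt_1 by lra; ring).
    set (x := 2 * a * y).
    assert (Hx : 0 < x < s 1).
    { rewrite Hs1; unfold x; split; [repeat apply Rmult_lt_0_compat; lra|].
      replace (2 * xi * a) with (2 * a * xi) by ring.
      apply Rmult_lt_compat_l; lra. }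
    assert (Ey : x / (2 * a * sqrt 1) = y) by (unfold x; rewrite sqrt_1; field; lra).
    destruct (Hux x 1 Rlt_0_1 Hx) as (ut & uxx & Ht & _ & Hxx & E).
    pose proof (similarity_is_derive_t x 1 Rlt_0_1 Hx) as Ht'.
    pose proof (similarity_is_derive_xx x 1 Rlt_0_1 Hx) as Hxx'.
    (* The given [ux] agrees with the explicit derivative near [x], hence so do the second
       derivatives. *)
    apply (is_derive_ext_loc _ (fun y => ux y 1)) in Hxx'.
    + cbv zeta in Ht'. rewrite Ey, Rpower_base_1 in Ht'. rewrite Ey, Rpower_base_1 in Hxx'.
      apply is_derive_unique in Ht, Ht', Hxx, Hxx'.
      rewrite Ht in Ht'; rewrite Hxx in Hxx'; rewrite Ht', Hxx' in E.
      apply Rmult_eq_reg_l with (1 / 4); [|lra].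
      transitivity (a ^ 2 * (1 / (4 * a ^ 2 * 1) * f2 y)); [field; lra|].
      rewrite <- E; field.
    + apply (filter_imp (fun z => 0 < z < s 1)); [|exact (locally_open_interval _ _ _ Hx)].
      intros z Hz; destruct (Hux z 1 Rlt_0_1 Hz) as (_ & _ & _ & Hz' & _).
      apply is_derive_unique in Hz'; rewrite <- Hz'.
      symmetry; apply is_derive_unique; exact (similarity_is_derive_x z 1 Rlt_0_1 Hz).
  - intros Ho.
    exists (fun x t => Rpower t (alpha / 2) * f1 (x / (2 * a * sqrt t)) / (2 * a * sqrt t)).
    intros x t Ht Hx; do 2 eexists; split; [|split; [|split]].
    + apply similarity_is_derive_t; assumption.
    + apply similarity_is_derive_x; assumption.
    + apply similarity_is_derive_xx; assumption.
    + rewrite Ho by (apply similarity_eta; assumption).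
      generalize (x / (2 * a * sqrt t)); intros eta; field; lra.
Qed.

End Similarity.

(** * The Stefan condition and the conditions at the fixed boundary *)

Lemma similarity_is_derive_s (a alpha xi : R) (phi : R -> R) (u : R -> R -> R)
    (s : R -> R) (t : R) :
  similarity_form a alpha xi phi u s -> 0 < t -> is_derive s t (xi * a / sqrt t).
Proof.
  intros [Hs _] Ht; pose proof (sqrt_lt_R0 t Ht).
  apply is_derive_ext_loc with (fun t => 2 * xi * a * sqrt t).
  - apply (filter_imp (fun tau => 0 < tau)); [|exact (open_gt 0 t Ht)].
    intros tau Htau; symmetry; exact (Hs tau Htau).
  - auto_derive; [exact Ht|field; lra].
Qed.

(** In powers of [t], [s^beta] contributes [beta/2] and [sdot^(delta+1)] contributes [-(delta+1)/2].
    The sum is the exponent of [u_x] exactly when [alpha = beta - delta]. The factor 2 occurs in [s]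
    but not in [sdot], whence [2^beta]. *)
Lemma stefan_scaling (a xi beta delta t : R) : 0 < a -> 0 < xi -> 0 < t ->
  Rpower (2 * xi * a * sqrt t) beta * Rpower (xi * a / sqrt t) delta * (xi * a / sqrt t)
  = Rpower t ((beta - delta) / 2) / sqrt t
    * (Rpower 2 beta * Rpower (xi * a) (beta + delta + 1)).
Proof.
  intros Ha Hxi Ht; pose proof (sqrt_lt_R0 t Ht) as Hst.
  assert (Hxa : 0 < xi * a) by (apply Rmult_lt_0_compat; assumption).
  assert (Els : ln (sqrt t) = ln t / 2).
  { rewrite <- (Rpower_sqrt t Ht); unfold Rpower; rewrite ln_exp; field. }
  replace (2 * xi * a * sqrt t) with (2 * (xi * a) * sqrt t) by ring.
  set (b := xi * a) in *; clearbody b.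
  rewrite <- !Rpower_mult_distr by (try apply Rmult_lt_0_compat; lra).
  unfold Rdiv at 1; rewrite <- Rpower_mult_distr by (try apply Rinv_0_lt_compat; lra).
  replace (b / sqrt t) with (Rpower b 1 / sqrt t)
    by (rewrite Rpower_1 by lra; reflexivity).
  rewrite !Rpower_plus.
  replace (Rpower t ((beta - delta) / 2))
    with (Rpower (sqrt t) beta * Rpower (/ sqrt t) delta).
  - field; lra.
  - unfold Rpower; rewrite ln_Rinv, Els, <- exp_plus by lra. f_equal; field.
Qed.

(** Both sides scale with the same power of [t], so the condition at [t = 1] implies it at all
    times; uniqueness of derivatives identifies the existential [ux] and [sdot] with the explicit
    ones. *)
Lemma similarity_stefan (a k gamma beta delta xi : R) (phi f1 : R -> R)
    (u : R -> R -> R) (s : R -> R) :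
  0 < a -> 0 < xi ->
  similarity_form a (beta - delta) xi phi u s ->
  D_in phi f1 (fun z => 0 <= z <= xi) xi ->
  (stefan_condition k gamma beta delta u s <->
   - k * f1 xi / (2 * a)
   = gamma * (Rpower 2 beta * Rpower (xi * a) (beta + delta + 1))).
Proof.
  intros Ha Hxi Hsim HD.
  assert (Hxa : 0 < xi * a) by (apply Rmult_lt_0_compat; assumption).
  assert (Hst : forall t, 0 < t -> 0 < s t).
  { intros t Ht; rewrite (proj1 Hsim) by exact Ht.
    pose proof (sqrt_lt_R0 t Ht); repeat apply Rmult_lt_0_compat; lra. }
  assert (Eeta : forall t, 0 < t -> s t / (2 * a * sqrt t) = xi).
  { intros t Ht; rewrite (proj1 Hsim) by exact Ht.
    pose proof (sqrt_lt_R0 t Ht); field; lra. }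
  assert (Hux : forall t, 0 < t -> is_dx u s (s t) t
    (Rpower t ((beta - delta) / 2) * f1 xi / (2 * a * sqrt t))).
  { intros t Ht. rewrite <- (Eeta t Ht) at 1.
    apply (similarity_is_dx a (beta - delta) xi phi); try assumption.
    - specialize (Hst t Ht); lra.
    - rewrite Eeta by exact Ht; exact HD. }
  split.
  - intros H; destruct (H 1 Rlt_0_1) as (ux & sd & _ & _ & Hx & Hd & E).
    rewrite (is_dx_unique u s (s 1) 1 _ _ (Hst 1 Rlt_0_1)
      ltac:(specialize (Hst 1 Rlt_0_1); lra) Hx (Hux 1 Rlt_0_1)) in E.
    apply is_derive_unique in Hd.
    pose proof (is_derive_unique _ _ _
      (similarity_is_derive_s _ _ _ _ _ _ 1 Hsim Rlt_0_1)) as Hd'.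
    rewrite Hd in Hd'; rewrite Hd', (proj1 Hsim 1 Rlt_0_1) in E.
    pose proof (stefan_scaling a xi beta delta 1 Ha Hxi Rlt_0_1) as ES.
    rewrite !Rmult_assoc in E; rewrite !Rmult_assoc in ES; rewrite ES in E.
    rewrite Rpower_base_1, sqrt_1 in E.
    transitivity (- k * (1 * (f1 xi / (2 * (a * 1))))); [field; lra|].
    etransitivity; [etransitivity; [|exact E]|]; field; lra.
  - intros E t Ht; do 2 eexists.
    pose proof (sqrt_lt_R0 t Ht) as Hsq.
    split; [exact (Hst t Ht)|split; [|split; [exact (Hux t Ht)|split;
      [exact (similarity_is_derive_s _ _ _ _ _ _ t Hsim Ht)|]]]].
    + apply Rdiv_lt_0_compat; assumption.
    + rewrite (proj1 Hsim t Ht).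
      transitivity (gamma * (Rpower (2 * xi * a * sqrt t) beta
        * Rpower (xi * a / sqrt t) delta * (xi * a / sqrt t))); [|ring].
      rewrite stefan_scaling by assumption.
      transitivity (Rpower t ((beta - delta) / 2) / sqrt t * (- k * f1 xi / (2 * a)));
        [field; lra|].
      rewrite E; ring.
Qed.

Lemma similarity_common_system (a k gamma beta delta xi : R) (phi f1 f2 : R -> R)
    (u : R -> R -> R) (s : R -> R) :
  0 < a -> 0 < xi ->
  C2_with phi f1 f2 xi -> similarity_form a (beta - delta) xi phi u s ->
  (common_system a k gamma beta delta u s <->
   (forall y, 0 < y < xi -> f2 y = -2 * y * f1 y + 2 * (beta - delta) * phi y) /\
   phi xi = 0 /\
   - k * f1 xi / (2 * a)
     = gamma * (Rpower 2 beta * Rpower (xi * a) (beta + delta + 1)) /\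
   s 0 = 0).
Proof.
  intros Ha Hxi HC Hsim.
  assert (HI : forall y, 0 < y < xi -> is_derive phi y (f1 y) /\ is_derive f1 y (f2 y)).
  { intros y Hy; destruct (HC y ltac:(lra)) as (D1 & D2 & _); split;
      eapply D_in_interior; eassumption. }
  pose proof (similarity_heat a (beta - delta) xi phi f1 f2 u s Ha Hxi HI Hsim) as Hheat.
  pose proof (similarity_stefan a k gamma beta delta xi phi f1 u s Ha Hxi Hsim
    (proj1 (HC xi ltac:(lra)))) as Hstef.
  assert (Hzero : (forall t, 0 < t -> u (s t) t = 0) <-> phi xi = 0).
  { assert (E : forall t, 0 < t -> u (s t) t = Rpower t ((beta - delta) / 2) * phi xi).
    { intros t Ht; pose proof (sqrt_lt_R0 t Ht) as Hsq.
      assert (0 < s t)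
        by (rewrite (proj1 Hsim) by exact Ht; repeat apply Rmult_lt_0_compat; lra).
      rewrite (proj2 Hsim) by lra. do 2 f_equal.
      rewrite (proj1 Hsim) by exact Ht; field; lra. }
    split.
    - intros H; pose proof (H 1 Rlt_0_1) as H1.
      rewrite E, Rpower_base_1 in H1 by lra; lra.
    - intros H t Ht; rewrite E, H by exact Ht; ring. }
  unfold common_system; tauto.
Qed.

(** The weights [1 / sqrt t] and [t^(alpha/2)] in the Robin condition match the scaling of [u_x], so
    again [t = 1] decides. *)
Lemma similarity_robin (a alpha k h0 uinf xi : R) (phi f1 : R -> R)
    (u : R -> R -> R) (s : R -> R) :
  0 < a -> 0 < xi -> similarity_form a alpha xi phi u s ->
  D_in phi f1 (fun z => 0 <= z <= xi) 0 ->
  ((forall t, 0 < t -> exists ux, is_dx u s 0 t ux /\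
      k * ux = h0 / sqrt t * (u 0 t - uinf * Rpower t (alpha / 2))) <->
   k * f1 0 / (2 * a) = h0 * (phi 0 - uinf)).
Proof.
  intros Ha Hxi Hsim HD.
  assert (Hst : forall t, 0 < t -> 0 < s t).
  { intros t Ht; rewrite (proj1 Hsim) by exact Ht.
    pose proof (sqrt_lt_R0 t Ht); repeat apply Rmult_lt_0_compat; lra. }
  assert (Eeta : forall t, 0 < t -> 0 / (2 * a * sqrt t) = 0).
  { intros t Ht; pose proof (sqrt_lt_R0 t Ht); field; lra. }
  assert (Hu : forall t, 0 < t -> u 0 t = Rpower t (alpha / 2) * phi 0).
  { intros t Ht; specialize (Hst t Ht).
    rewrite (proj2 Hsim), Eeta by lra; reflexivity. }
  assert (Hux : forall t, 0 < t -> is_dx u s 0 t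
    (Rpower t (alpha / 2) * f1 0 / (2 * a * sqrt t))).
  { intros t Ht. rewrite <- (Eeta t Ht) at 2.
    apply (similarity_is_dx a alpha xi phi); try assumption.
    - specialize (Hst t Ht); lra.
    - rewrite Eeta by exact Ht; exact HD. }
  split.
  - intros H; destruct (H 1 Rlt_0_1) as (ux & Hx & E).
    rewrite (is_dx_unique u s 0 1 _ _ (Hst 1 Rlt_0_1)
      ltac:(specialize (Hst 1 Rlt_0_1); lra) Hx (Hux 1 Rlt_0_1)) in E.
    rewrite Hu, Rpower_base_1, sqrt_1 in E by lra.
    etransitivity; [etransitivity; [|exact E]|]; field; lra.
  - intros E t Ht; eexists; split; [exact (Hux t Ht)|].
    pose proof (sqrt_lt_R0 t Ht) as Hsq.
    transitivity (Rpower t (alpha / 2) / sqrt t * (k * f1 0 / (2 * a)));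
      [field; lra|].
    rewrite E, Hu by exact Ht; field; lra.
Qed.

Lemma similarity_dirichlet (a alpha u0 xi : R) (phi : R -> R)
    (u : R -> R -> R) (s : R -> R) :
  0 < a -> 0 < xi -> similarity_form a alpha xi phi u s ->
  ((forall t, 0 < t -> u 0 t = u0 * Rpower t (alpha / 2)) <-> phi 0 = u0).
Proof.
  intros Ha Hxi Hsim.
  assert (Hu : forall t, 0 < t -> u 0 t = Rpower t (alpha / 2) * phi 0).
  { intros t Ht; pose proof (sqrt_lt_R0 t Ht).
    assert (0 < s t)
      by (rewrite (proj1 Hsim) by exact Ht; repeat apply Rmult_lt_0_compat; lra).
    rewrite (proj2 Hsim) by lra. do 2 f_equal; field; lra. }
  split.
  - intros H; pose proof (H 1 Rlt_0_1) as H1.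
    rewrite Hu, Rpower_base_1 in H1 by lra; lra.
  - intros H t Ht; rewrite Hu, H by exact Ht; ring.
Qed.

(** * The transcendental equations *)

(* In the variable [w = ln z] the function [z^m * F z] is continuous on all of R,
   and it takes values on both sides of K at [z = 1] and at [z^m = K / F 1]. *)
Lemma power_root_exists (F : R -> R) (m K : R) : 0 < m -> 0 < K ->
  (forall z, 0 < z -> 0 < F z) ->
  (forall y z, 0 < y <= z -> F y <= F z) ->
  (forall z, 0 < z -> continuity_pt F z) ->
  exists z, 0 < z /\ Rpower z m * F z = K.
Proof.
  intros Hm HK HF Hmon Hc.
  set (h := fun w => exp (m * w) * F (exp w)).
  pose proof (HF 1 Rlt_0_1) as HF1.
  set (w1 := ln (K / F 1) / m).
  assert (Hh0 : h 0 = F 1) by (unfold h; rewrite Rmult_0_r, exp_0; ring).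
  assert (E1 : exp (m * w1) = K / F 1).
  { unfold w1; replace (m * (ln (K / F 1) / m)) with (ln (K / F 1)) by (field; lra).
    apply exp_ln, Rdiv_lt_0_compat; assumption. }
  assert (Hh1 : h w1 = K / F 1 * F (exp w1)) by (unfold h; rewrite E1; reflexivity).
  assert (HKF : 0 < K / F 1) by (apply Rdiv_lt_0_compat; assumption).
  destruct (IVT_gen h 0 w1 K) as [w [_ Hw]].
  - intros w; apply (continuity_pt_mult (fun w => exp (m * w)) (fun w => F (exp w))).
    + apply (is_derive_continuity_pt _ w (m * exp (m * w))); auto_derive; [trivial|ring].
    + apply (continuity_pt_comp exp F);
        [apply derivable_continuous_pt, derivable_pt_exp|apply Hc, exp_pos].
  - rewrite Hh0, Hh1; set (r := K / F 1) in *.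
    assert (EK : K = r * F 1) by (unfold r; field; lra).
    clearbody r; rewrite EK.
    (* If [w1 >= 0] then [r >= 1] and [F 1 <= r F 1 <= r F(exp w1)]; if [w1 < 0] both inequalities
       reverse. *)
    destruct (Rle_lt_dec 0 w1) as [Hw|Hw].
    + assert (H1 : 1 <= exp w1).
      { rewrite <- exp_0; destruct Hw as [Hw|<-];
          [left; apply exp_increasing; exact Hw|right; reflexivity]. }
      assert (H2 : 1 <= r).
      { rewrite <- E1, <- exp_0.
        assert (0 <= m * w1) as [Hmw|<-] by (apply Rmult_le_pos; lra);
          [left; apply exp_increasing; exact Hmw|right; reflexivity]. }
      split; [apply Rle_trans with (1 := Rmin_l _ _)|
              apply Rle_trans with (2 := Rmax_r _ _)].
      * rewrite <- (Rmult_1_l (F 1)) at 1; apply Rmult_le_compat_r; lra.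
      * apply Rmult_le_compat_l; [lra|apply Hmon; lra].
    + assert (H1 : exp w1 < 1) by (rewrite <- exp_0; apply exp_increasing; exact Hw).
      assert (H2 : r < 1).
      { rewrite <- E1, <- exp_0; apply exp_increasing.
        rewrite <- (Rmult_0_r m); apply Rmult_lt_compat_l; lra. }
      split; [apply Rle_trans with (1 := Rmin_r _ _)|
              apply Rle_trans with (2 := Rmax_l _ _)].
      * apply Rmult_le_compat_l; [lra|apply Hmon]. pose proof (exp_pos w1); lra.
      * rewrite <- (Rmult_1_l (F 1)) at 2; apply Rmult_le_compat_r; lra.
  - exists (exp w); split; [apply exp_pos|].
    unfold Rpower; rewrite ln_exp; exact Hw.
Qed.

(** Strict growth comes from the power [z^m]; the factor [F] need only be positive and
    nondecreasing. *)
Lemma power_root_unique (F : R -> R) (m K y z : R) : 0 < m ->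
  (forall z, 0 < z -> 0 < F z) ->
  (forall y z, 0 < y <= z -> F y <= F z) ->
  0 < y -> 0 < z ->
  Rpower y m * F y = K -> Rpower z m * F z = K -> y = z.
Proof.
  intros Hm HF Hmon.
  assert (Hlt : forall y z, 0 < y -> y < z -> Rpower y m * F y < Rpower z m * F z).
  { intros v w Hv Hvw; apply Rlt_le_trans with (Rpower w m * F v).
    - apply Rmult_lt_compat_r; [apply HF; exact Hv|apply Rlt_Rpower_l; lra].
    - apply Rmult_le_compat_l; [left; apply exp_pos|apply Hmon; lra]. }
  intros Hy Hz Ey Ez; destruct (Rtotal_order y z) as [H|[H|H]]; [|exact H|].
  - pose proof (Hlt y z Hy H); lra.
  - pose proof (Hlt z y Hz H); lra.
Qed.

(** [P] and [Q] have positive first parameters for [alpha >= 0], so their series have nonnegative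
    coefficients in [y^2], which gives positivity and monotonicity. *)
Definition kummer_P (alpha y : R) : R := kummer_M (alpha / 2 + 1 / 2) (1 / 2) (y ^ 2).
Definition kummer_Q (alpha y : R) : R := y * kummer_M (alpha / 2 + 1) (3 / 2) (y ^ 2).

Lemma kummer_P_pos (alpha y : R) : 0 <= alpha -> 0 < kummer_P alpha y.
Proof.
  intros H; apply Rlt_le_trans with 1; [lra|].
  apply kummer_M_ge1; [lra|lra|apply pow2_ge_0].
Qed.

Lemma kummer_Q_pos (alpha y : R) : 0 <= alpha -> 0 < y -> 0 < kummer_Q alpha y.
Proof.
  intros H Hy; apply Rmult_lt_0_compat; [exact Hy|].
  apply Rlt_le_trans with 1; [lra|].
  apply kummer_M_ge1; [lra|lra|apply pow2_ge_0].
Qed.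

Lemma kummer_P_le (alpha y z : R) : 0 <= alpha -> 0 <= y <= z ->
  kummer_P alpha y <= kummer_P alpha z.
Proof.
  intros H Hyz; apply kummer_M_le; [lra|lra|].
  split; [apply pow2_ge_0|apply pow_incr; exact Hyz].
Qed.

Lemma kummer_Q_le (alpha y z : R) : 0 <= alpha -> 0 <= y <= z ->
  kummer_Q alpha y <= kummer_Q alpha z.
Proof.
  intros H Hyz; apply Rmult_le_compat; [lra| |lra|].
  - apply Rle_trans with 1; [lra|apply kummer_M_ge1; [lra|lra|apply pow2_ge_0]].
  - apply kummer_M_le; [lra|lra|].
    split; [apply pow2_ge_0|apply pow_incr; exact Hyz].
Qed.

Lemma kummer_P_continuous (alpha y : R) : continuity_pt (kummer_P alpha) y.
Proof.
  apply (continuity_pt_comp (fun y => y ^ 2) (kummer_M (alpha / 2 + 1 / 2) (1 / 2))).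
  - apply derivable_continuous_pt, derivable_pt_pow.
  - apply (is_derive_continuity_pt _ _ _
      (is_derive_kummer_M (alpha / 2 + 1 / 2) (1 / 2) (y ^ 2) ltac:(lra))).
Qed.

Lemma kummer_Q_continuous (alpha y : R) : continuity_pt (kummer_Q alpha) y.
Proof.
  apply (continuity_pt_mult (fun y => y)
    (fun y => kummer_M (alpha / 2 + 1) (3 / 2) (y ^ 2))).
  - apply derivable_continuous_pt, derivable_pt_id.
  - apply (continuity_pt_comp (fun y => y ^ 2) (kummer_M (alpha / 2 + 1) (3 / 2))).
    + apply derivable_continuous_pt, derivable_pt_pow.
    + apply (is_derive_continuity_pt _ _ _
        (is_derive_kummer_M (alpha / 2 + 1) (3 / 2) (y ^ 2) ltac:(lra))).
Qed.

Definition robin_denominator (c alpha y : R) : R := c * kummer_P alpha y + kummer_Q alpha y.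

Lemma robin_denominator_pos (c alpha y : R) : 0 <= c -> 0 <= alpha -> 0 < y ->
  0 < robin_denominator c alpha y.
Proof.
  intros Hc Ha Hy; pose proof (kummer_Q_pos alpha y Ha Hy).
  pose proof (Rmult_le_pos c _ Hc (Rlt_le _ _ (kummer_P_pos alpha y Ha))).
  unfold robin_denominator; lra.
Qed.

Lemma robin_denominator_le (c alpha y z : R) : 0 <= c -> 0 <= alpha -> 0 < y <= z ->
  robin_denominator c alpha y <= robin_denominator c alpha z.
Proof.
  intros Hc Ha Hyz; apply Rplus_le_compat.
  - apply Rmult_le_compat_l; [exact Hc|apply kummer_P_le; lra].
  - apply kummer_Q_le; lra.
Qed.

Lemma robin_denominator_continuous (c alpha y : R) :
  continuity_pt (robin_denominator c alpha) y.
Proof.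
  apply (continuity_pt_plus (fun y => c * kummer_P alpha y) (kummer_Q alpha)).
  - apply (continuity_pt_scal (kummer_P alpha)), kummer_P_continuous.
  - apply kummer_Q_continuous.
Qed.

(* The common form of the two transcendental equations: [c = k / (2 a h0)] for
   the Robin problem and [c = 0] for the Dirichlet problem. *)
Definition front_equation (a k gamma beta delta c v z : R) : Prop :=
  0 < z /\
  k * v / (2 * a * robin_denominator c (beta - delta) z)
  = gamma * (Rpower 2 beta * Rpower (z * a) (beta + delta + 1)).

(** The Stefan condition in the form [z^m F(z) = K] of the root lemmas. The factor [1 / (2 a)] from
    the chain rule raises [2^beta] and [a^(beta+delta+1)] by one power each. *)
Lemma front_equation_power (a k gamma beta delta c v z : R) :
  0 < a -> 0 < gamma -> 0 <= c -> 0 <= beta - delta -> 0 < z ->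
  (front_equation a k gamma beta delta c v z <->
   Rpower z (beta + delta + 1) * robin_denominator c (beta - delta) z
   = k * v / (gamma * Rpower 2 (beta + 1) * Rpower a (beta + delta + 2))).
Proof.
  intros Ha Hg Hc Hal Hz; unfold front_equation.
  pose proof (robin_denominator_pos c _ z Hc Hal Hz) as HD.
  set (D := robin_denominator c (beta - delta) z) in *; clearbody D.
  rewrite <- Rpower_mult_distr by assumption.
  replace (beta + delta + 2) with (beta + delta + 1 + 1) by ring.
  rewrite (Rpower_plus (beta + delta + 1) 1 a), (Rpower_plus beta 1 2), !Rpower_1 by lra.
  assert (H2 : 0 < Rpower 2 beta) by apply exp_pos.
  assert (H3 : 0 < Rpower a (beta + delta + 1)) by apply exp_pos.
  set (p2 := Rpower 2 beta) in *; set (pa := Rpower a (beta + delta + 1)) in *.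
  set (pz := Rpower z (beta + delta + 1)); clearbody p2 pa pz.
  split.
  - intros [_ E].
    transitivity (gamma * (p2 * (pz * pa)) * D / (gamma * p2 * pa)); [field; lra|].
    rewrite <- E; field; lra.
  - intros E; split; [exact Hz|].
    transitivity (k * v / (gamma * (p2 * 2) * (pa * a)) * (gamma * p2 * pa) / D);
      [field; lra|].
    rewrite <- E; field; lra.
Qed.

Lemma positive_root_R_front (a k gamma beta delta h0 uinf z : R) :
  0 < a -> 0 < k -> 0 < gamma -> 0 < h0 -> 0 <= beta - delta ->
  (positive_root_R a k gamma beta delta h0 uinf z <->
   front_equation a k gamma beta delta (k / (2 * a * h0)) uinf z).
Proof.
  intros Ha Hk Hg Hh Hal.
  assert (Hc : 0 < k / (2 * a * h0))
    by (apply Rdiv_lt_0_compat; repeat apply Rmult_lt_0_compat; lra).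
  unfold positive_root_R; fold (kummer_P (beta - delta) z).
  fold (kummer_Q (beta - delta) z).
  fold (robin_denominator (k / (2 * a * h0)) (beta - delta) z).
  enough (Hz : 0 < z -> (k * uinf / (gamma * Rpower 2 (beta + 1) * Rpower a (beta + delta + 2))
      * (1 / robin_denominator (k / (2 * a * h0)) (beta - delta) z)
      = Rpower z (beta + delta + 1) <->
      front_equation a k gamma beta delta (k / (2 * a * h0)) uinf z)).
  { split; [intros [Hz' E]; apply (Hz Hz'); exact E|].
    intros H; split; [apply H|apply (Hz (proj1 H)); exact H]. }
  intros Hz; rewrite front_equation_power by lra.
  pose proof (robin_denominator_pos _ _ z (Rlt_le _ _ Hc) Hal Hz) as HD.
  set (K := k * uinf / _); clearbody K.
  split; [intros <-|intros <-]; field; lra.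
Qed.

Lemma robin_denominator_0 (alpha y : R) : robin_denominator 0 alpha y = kummer_Q alpha y.
Proof. unfold robin_denominator; ring. Qed.

Lemma positive_root_D_front (a k gamma beta delta u0 z : R) :
  0 < a -> 0 < gamma -> 0 <= beta - delta ->
  (positive_root_D a k gamma beta delta u0 z <->
   front_equation a k gamma beta delta 0 u0 z).
Proof.
  intros Ha Hg Hal.
  unfold positive_root_D; fold (kummer_Q (beta - delta) z).
  rewrite <- robin_denominator_0.
  enough (Hz : 0 < z -> (k * u0 / (gamma * Rpower 2 (beta + 1) * Rpower a (beta + delta + 2))
      * (1 / robin_denominator 0 (beta - delta) z)
      = Rpower z (beta + delta + 1) <->
      front_equation a k gamma beta delta 0 u0 z)).
  { split; [intros [Hz' E]; apply (Hz Hz'); exact E|].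
    intros H; split; [apply H|apply (Hz (proj1 H)); exact H]. }
  intros Hz; rewrite front_equation_power by lra.
  pose proof (robin_denominator_pos _ _ z (Rle_refl 0) Hal Hz) as HD.
  set (K := k * u0 / _); clearbody K.
  split; [intros <-|intros <-]; field; lra.
Qed.

Lemma front_equation_unique (a k gamma beta delta c v y z : R) :
  0 < a -> 0 < gamma -> 0 <= c -> 0 <= beta - delta -> beta + delta + 1 > 0 ->
  front_equation a k gamma beta delta c v y ->
  front_equation a k gamma beta delta c v z -> y = z.
Proof.
  intros Ha Hg Hc Hal Hm Hy Hz.
  apply (power_root_unique (robin_denominator c (beta - delta)) (beta + delta + 1)
    (k * v / (gamma * Rpower 2 (beta + 1) * Rpower a (beta + delta + 2))) y z Hm).
  - intros w; apply robin_denominator_pos; assumption.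
  - intros w w'; apply robin_denominator_le; assumption.
  - apply Hy.
  - apply Hz.
  - apply front_equation_power; try assumption; apply Hy.
  - apply front_equation_power; try assumption; apply Hz.
Qed.

Lemma front_equation_exists (a k gamma beta delta c v : R) :
  0 < a -> 0 < k -> 0 < gamma -> 0 < v -> 0 <= c -> 0 <= beta - delta ->
  beta + delta + 1 > 0 ->
  exists z, front_equation a k gamma beta delta c v z.
Proof.
  intros Ha Hk Hg Hv Hc Hal Hm.
  destruct (power_root_exists (robin_denominator c (beta - delta)) (beta + delta + 1)
    (k * v / (gamma * Rpower 2 (beta + 1) * Rpower a (beta + delta + 2))) Hm)
    as (z & Hz & E).
  - apply Rdiv_lt_0_compat; repeat apply Rmult_lt_0_compat; try apply exp_pos; lra.
  - intros w; apply robin_denominator_pos; assumption.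
  - intros w w'; apply robin_denominator_le; assumption.
  - intros w _; apply robin_denominator_continuous.
  - exists z; apply front_equation_power; assumption.
Qed.

(** * Similarity solutions *)

(* With [A = exp(-y^2) P] and [B = exp(-y^2) Q] the Wronskian identity at the
   free boundary reads [P B' - A' Q = 1]. *)
Lemma profile_endpoint (alpha xi : R) (A1 B1 phi f1 f2 : R -> R) :
  0 < xi ->
  fundamental_pair (2 * alpha) (kummer_A alpha) A1 (kummer_B alpha) B1 ->
  C2_with phi f1 f2 xi ->
  (forall y, 0 < y < xi -> f2 y = -2 * y * f1 y + 2 * alpha * phi y) ->
  phi xi = 0 ->
  phi 0 = - f1 xi * kummer_Q alpha xi /\ f1 0 = f1 xi * kummer_P alpha xi.
Proof.
  intros Hxi HP HC Ho H0.
  pose proof (wronskian _ _ _ _ _ HP xi ltac:(lra)) as HW.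
  rewrite kummer_A_transform, kummer_B_transform in HW by lra.
  fold (kummer_P alpha xi) (kummer_Q alpha xi) in HW.
  destruct (fundamental_span_D_in _ xi _ _ _ _ phi f1 f2 Hxi HP
    (fun y Hy => conj (proj1 (HC y Hy)) (proj1 (proj2 (HC y Hy)))) Ho xi ltac:(lra))
    as [E0 E1].
  rewrite H0, kummer_A_transform, kummer_B_transform in E0 by lra.
  fold (kummer_P alpha xi) (kummer_Q alpha xi) in E0.
  pose proof (exp_pos (- xi ^ 2)) as He.
  assert (Hee : exp (- xi ^ 2) * exp (xi ^ 2) = 1)
    by (rewrite <- exp_plus, Rplus_opp_l; apply exp_0).
  set (P := kummer_P alpha xi) in *; set (Q := kummer_Q alpha xi) in *.
  assert (HW' : P * B1 xi - A1 xi * Q = 1).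
  { rewrite <- HW, <- (Rmult_1_r (P * B1 xi - A1 xi * Q)), <- Hee; ring. }
  assert (E0' : phi 0 * P + f1 0 * Q = 0).
  { apply Rmult_eq_reg_l with (exp (- xi ^ 2)); [|lra].
    rewrite Rmult_0_r; etransitivity; [|symmetry; exact E0]; ring. }
  (* [E0'] and [E1] form a linear system for [phi 0] and [f1 0] whose determinant is 1 by [HW']. *)
  rewrite E1; split.
  - transitivity (phi 0 * (P * B1 xi - A1 xi * Q) - B1 xi * (phi 0 * P + f1 0 * Q));
      [rewrite HW', E0'; ring|ring].
  - transitivity (f1 0 * (P * B1 xi - A1 xi * Q) + A1 xi * (phi 0 * P + f1 0 * Q));
      [rewrite HW', E0'; ring|ring].
Qed.

(** The Robin condition [c phi'(0) = phi(0) - v] with both boundary values expressed through the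
    flux [w] at the free boundary; it is linear in [w]. *)
Lemma profile_flux_iff (c v p q w : R) :
  0 < c * p + q -> (c * (w * p) = - w * q - v <-> w = - v / (c * p + q)).
Proof.
  intros HD; split.
  - intros E; apply Rmult_eq_reg_r with (c * p + q); [|lra].
    transitivity (- v); [lra|field; lra].
  - intros ->; field; lra.
Qed.

(** The boundary data at [x = 0] enter the right-hand side only through [xiR] and the flux there,
    which makes it comparable with its Dirichlet counterpart. *)
Lemma similarity_solution_R_profile
  (a k gamma h0 uinf beta delta xiR : R) (u : R -> R -> R) (s : R -> R) :
  0 < a -> 0 < k -> 0 < gamma -> 0 < h0 ->
  0 <= beta - delta -> beta + delta + 1 > 0 ->
  front_equation a k gamma beta delta (k / (2 * a * h0)) uinf xiR ->
  (similarity_solution (problem_R a k gamma beta delta h0 uinf) a (beta - delta) u s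
   <->
   common_system a k gamma beta delta u s /\
   exists phi f1 f2, similarity_form a (beta - delta) xiR phi u s /\
     C2_with phi f1 f2 xiR /\
     f1 xiR = - uinf / robin_denominator (k / (2 * a * h0)) (beta - delta) xiR).
Proof.
  intros Ha Hk Hg Hh Hal Hm HxiR.
  set (c := k / (2 * a * h0)) in *.
  assert (Hc : 0 < c)
    by (apply Rdiv_lt_0_compat; repeat apply Rmult_lt_0_compat; lra).
  destruct (kummer_fundamental (beta - delta)) as (A1 & B1 & HP).
  assert (Hrob : forall v w, k * w / (2 * a) = h0 * (v - uinf) <-> c * w = v - uinf).
  { intros v w; unfold c; split; intros E.
    - apply Rmult_eq_reg_l with h0; [|lra]. rewrite <- E; field; lra.
    - rewrite <- E; field; lra. }
  (* Stated for every [xi], since the flux is needed before the front constant is known to be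
     [xiR]. *)
  assert (Hflux : forall xi phi f1 f2, 0 < xi -> C2_with phi f1 f2 xi ->
    similarity_form a (beta - delta) xi phi u s ->
    common_system a k gamma beta delta u s ->
    (k * f1 0 / (2 * a) = h0 * (phi 0 - uinf) <->
     f1 xi = - uinf / robin_denominator c (beta - delta) xi)).
  { intros xi phi f1 f2 Hxi HC Hsim Hcs.
    apply (similarity_common_system a k gamma beta delta xi phi f1 f2) in Hcs;
      try assumption.
    destruct Hcs as (Ho & Hz & _ & _).
    destruct (profile_endpoint _ _ _ _ _ _ _ Hxi HP HC Ho Hz) as [E0 E1].
    rewrite Hrob, E0, E1. apply profile_flux_iff.
    exact (robin_denominator_pos c (beta - delta) xi ltac:(lra) Hal Hxi). }
  split.
  - intros [[Hcs Hbc] (xi & phi & Hxi & (f1 & f2 & HC) & Hsim)].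
    change (C2_with phi f1 f2 xi) in HC.
    change (similarity_form a (beta - delta) xi phi u s) in Hsim.
    apply (similarity_robin a (beta - delta) k h0 uinf xi phi f1) in Hbc;
      try assumption; [|apply HC; lra].
    apply (Hflux xi phi f1 f2) in Hbc; try assumption.
    pose proof (proj1 (similarity_common_system a k gamma beta delta xi phi f1 f2
      u s Ha Hxi HC Hsim) Hcs) as (_ & _ & HS & _).
    pose proof (robin_denominator_pos c (beta - delta) xi ltac:(lra) Hal Hxi).
    assert (E : xi = xiR).
    (* With the flux inserted, the Stefan condition [HS] is the front equation for [xi]. *)
    { apply (front_equation_unique a k gamma beta delta c uinf); try assumption; [lra|].
      split; [exact Hxi|]. rewrite <- HS, Hbc; field; lra. }
    subst xiR; split; [exact Hcs|].
    exists phi, f1, f2; split; [exact Hsim|split; assumption].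
  - intros [Hcs (phi & f1 & f2 & Hsim & HC & E)].
    pose proof (proj1 HxiR) as Hxi.
    split; [split; [exact Hcs|]|].
    + apply (similarity_robin a (beta - delta) k h0 uinf xiR phi f1);
        try assumption; [apply HC; lra|].
      apply (Hflux xiR phi f1 f2); assumption.
    + exists xiR, phi; split; [exact Hxi|split; [|exact Hsim]].
      exists f1, f2; exact HC.
Qed.

Lemma similarity_solution_D_profile
  (a k gamma u0 beta delta xiD : R) (u : R -> R -> R) (s : R -> R) :
  0 < a -> 0 < gamma -> 0 <= beta - delta -> beta + delta + 1 > 0 ->
  front_equation a k gamma beta delta 0 u0 xiD ->
  (similarity_solution (problem_D a k gamma beta delta u0) a (beta - delta) u s
   <->
   common_system a k gamma beta delta u s /\
   exists phi f1 f2, similarity_form a (beta - delta) xiD phi u s /\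
     C2_with phi f1 f2 xiD /\
     f1 xiD = - u0 / kummer_Q (beta - delta) xiD).
Proof.
  intros Ha Hg Hal Hm HxiD.
  destruct (kummer_fundamental (beta - delta)) as (A1 & B1 & HP).
  assert (Hflux : forall xi phi f1 f2, 0 < xi -> C2_with phi f1 f2 xi ->
    similarity_form a (beta - delta) xi phi u s ->
    common_system a k gamma beta delta u s ->
    (phi 0 = u0 <-> f1 xi = - u0 / kummer_Q (beta - delta) xi)).
  { intros xi phi f1 f2 Hxi HC Hsim Hcs.
    apply (similarity_common_system a k gamma beta delta xi phi f1 f2) in Hcs;
      try assumption.
    destruct Hcs as (Ho & Hz & _ & _).
    destruct (profile_endpoint _ _ _ _ _ _ _ Hxi HP HC Ho Hz) as [E0 _].
    pose proof (kummer_Q_pos (beta - delta) xi Hal Hxi).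
    rewrite E0; split; [intros <-; field; lra|intros ->; field; lra]. }
  split.
  - intros [[Hcs Hbc] (xi & phi & Hxi & (f1 & f2 & HC) & Hsim)].
    change (C2_with phi f1 f2 xi) in HC.
    change (similarity_form a (beta - delta) xi phi u s) in Hsim.
    apply (similarity_dirichlet a (beta - delta) u0 xi phi u s Ha Hxi Hsim) in Hbc.
    apply (Hflux xi phi f1 f2) in Hbc; try assumption.
    pose proof (proj1 (similarity_common_system a k gamma beta delta xi phi f1 f2
      u s Ha Hxi HC Hsim) Hcs) as (_ & _ & HS & _).
    pose proof (kummer_Q_pos (beta - delta) xi Hal Hxi).
    assert (E : xi = xiD).
    { apply (front_equation_unique a k gamma beta delta 0 u0); try assumption; [lra|].
      split; [exact Hxi|]. rewrite robin_denominator_0, <- HS, Hbc; field; lra. }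
    subst xiD; split; [exact Hcs|].
    exists phi, f1, f2; split; [exact Hsim|split; assumption].
  - intros [Hcs (phi & f1 & f2 & Hsim & HC & E)].
    pose proof (proj1 HxiD) as Hxi.
    split; [split; [exact Hcs|]|].
    + apply (similarity_dirichlet a (beta - delta) u0 xiD phi u s Ha Hxi Hsim).
      apply (Hflux xiD phi f1 f2); assumption.
    + exists xiD, phi; split; [exact Hxi|split; [|exact Hsim]].
      exists f1, f2; exact HC.
Qed.

(** Existence is by the explicit combination of [A] and [B]. For uniqueness, the flux prescribed at
    [xi] determines value and slope at 0 of any competing profile. *)
Lemma unique_similarity_solution_D
  (a k gamma u0 beta delta xi : R) :
  0 < a -> 0 < gamma -> 0 <= beta - delta -> beta + delta + 1 > 0 ->
  front_equation a k gamma beta delta 0 u0 xi ->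
  exists u s,
    unique_similarity_solution (problem_D a k gamma beta delta u0) a (beta - delta) u s.
Proof.
  intros Ha Hg Hal Hm Hxi; pose proof (proj1 Hxi) as Hxi0.
  set (alpha := beta - delta) in *.
  destruct (kummer_fundamental alpha) as (A1 & B1 & HP).
  pose proof (kummer_P_pos alpha xi Hal) as HPp.
  pose proof (kummer_Q_pos alpha xi Hal Hxi0) as HQp.
  (* This is [- u0 A(xi) / B(xi)] with the Gaussian factors cancelled, the choice for which [phi]
     vanishes at [xi]. *)
  set (v0 := - u0 * kummer_P alpha xi / kummer_Q alpha xi).
  set (phi := fun y => u0 * kummer_A alpha y + v0 * kummer_B alpha y).
  set (f1 := fun y => u0 * A1 y + v0 * B1 y).
  set (f2 := fun y => -2 * y * f1 y + 2 * alpha * phi y).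
  set (s := fun t => 2 * xi * a * sqrt t).
  set (u := fun x t => Rpower t (alpha / 2) * phi (x / (2 * a * sqrt t))).
  assert (Hode : forall y, is_derive phi y (f1 y) /\ is_derive f1 y (f2 y)).
  { intros y; destruct (fp_A _ _ _ _ _ HP y) as [a0 a1], (fp_B _ _ _ _ _ HP y) as [b0 b1].
    split; [unfold phi|unfold f1]; auto_derive;
      try (repeat split; eexists; eassumption); rewrite_derives; unfold f2, f1, phi; ring. }
  assert (HC : C2_with phi f1 f2 xi).
  { intros y _; destruct (Hode y) as [D1 D2].
    split; [exact (is_derive_D_in _ _ _ _ D1)|].
    split; [exact (is_derive_D_in _ _ _ _ D2)|].
    (* Continuity of [f2] follows from its differentiability; the witness is the derivative of the
       right-hand side of the equation. *)
    apply (cont_deriv _ (fun y => -2 * f1 y + -2 * y * f2 y + 2 * alpha * f1 y)).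
    apply is_derive_D_in; unfold f2 at 1; auto_derive;
      [repeat split; eexists; eassumption|]. rewrite_derives; ring. }
  assert (Hsim : similarity_form a alpha xi phi u s) by (split; reflexivity).
  assert (Hphi0 : phi 0 = u0).
  { unfold phi; rewrite (fp_A0 _ _ _ _ _ HP), (fp_B0 _ _ _ _ _ HP); ring. }
  assert (Hphixi : phi xi = 0).
  { unfold phi; rewrite kummer_A_transform, kummer_B_transform by lra.
    fold (kummer_P alpha xi) (kummer_Q alpha xi); unfold v0; field; lra. }
  destruct (profile_endpoint alpha xi A1 B1 phi f1 f2 Hxi0 HP HC
    (fun y _ => eq_refl) Hphixi) as [E0 _].
  assert (Hf1 : f1 xi = - u0 / kummer_Q alpha xi) by (rewrite <- Hphi0, E0; field; lra).
  exists u, s; split.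
  - apply (similarity_solution_D_profile a k gamma u0 beta delta xi); try assumption.
    split; [|exists phi, f1, f2; split; [exact Hsim|split; assumption]].
    apply (similarity_common_system a k gamma beta delta xi phi f1 f2); try assumption.
    split; [reflexivity|]. split; [exact Hphixi|]. split.
    + destruct Hxi as [_ <-]. fold alpha; rewrite robin_denominator_0, Hf1; field; lra.
    + unfold s; rewrite sqrt_0; ring.
  - intros u' s' H.
    apply (similarity_solution_D_profile a k gamma u0 beta delta xi) in H; try assumption.
    destruct H as [Hcs (psi & g1 & g2 & Hsim' & HC' & Hg1)]; fold alpha in Hsim', Hg1.
    apply (similarity_common_system a k gamma beta delta xi psi g1 g2) in Hcs;
      try assumption; fold alpha in Hcs.
    destruct Hcs as (Ho & Hz & _ & Hs0).
    destruct (profile_endpoint alpha xi A1 B1 psi g1 g2 Hxi0 HP HC' Ho Hz) as [F0 F1].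
    assert (Hs : forall t, 0 <= t -> s t = s' t).
    (* The similarity form covers only [t > 0]; at [t = 0] the initial condition on [s'] is used. *)
    { intros t [Ht|<-]; [symmetry; exact (proj1 Hsim' t Ht)|].
      rewrite Hs0; unfold s; rewrite sqrt_0; ring. }
    split; [exact Hs|].
    intros x t Ht Hx; rewrite (proj2 Hsim') by (rewrite <- ?Hs; lra).
    unfold u; f_equal.
    assert (Heta : 0 <= x / (2 * a * sqrt t) <= xi).
    { pose proof (sqrt_lt_R0 t Ht); unfold s in Hx.
      assert (0 < 2 * a * sqrt t) by (repeat apply Rmult_lt_0_compat; lra).
      split; [apply Rdiv_le_0_compat; lra|apply Rle_div_l; lra]. }
    rewrite (proj1 (fundamental_span_D_in _ xi _ _ _ _ psi g1 g2 Hxi0 HP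
      (fun y Hy => conj (proj1 (HC' y Hy)) (proj1 (proj2 (HC' y Hy)))) Ho _ Heta)).
    unfold phi, v0; rewrite F0, F1, Hg1; f_equal; [f_equal|f_equal]; field; lra.
Qed.

Theorem corollary3p2
  (a k gamma h0 uinf u0 beta delta alpha : R)
  (ha : 0 < a) (hk : 0 < k) (hgamma : 0 < gamma)
  (hh0 : 0 < h0) (huinf : 0 < uinf) (hu0 : 0 < u0)
  (hbd : beta >= delta) (hbd1 : beta + delta + 1 > 0)
  (halpha : alpha = beta - delta) :
  (exists! z, positive_root_R a k gamma beta delta h0 uinf z) /\
  forall xiR : R,
    positive_root_R a k gamma beta delta h0 uinf xiR ->
    u0 = uinf * xiR * kummer_M (- alpha / 2 + 1 / 2) (3 / 2) (- xiR ^ 2)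
         / (k / (2 * a * h0) * kummer_M (- alpha / 2) (1 / 2) (- xiR ^ 2)
            + xiR * kummer_M (- alpha / 2 + 1 / 2) (3 / 2) (- xiR ^ 2)) ->
    (forall (u : R -> R -> R) (s : R -> R),
       similarity_solution (problem_R a k gamma beta delta h0 uinf) a alpha u s
       <->
       similarity_solution (problem_D a k gamma beta delta u0) a alpha u s) /\
    (exists (u : R -> R -> R) (s : R -> R),
       unique_similarity_solution
         (problem_R a k gamma beta delta h0 uinf) a alpha u s /\
       unique_similarity_solution
         (problem_D a k gamma beta delta u0) a alpha u s) /\
    unique (positive_root_D a k gamma beta delta u0) xiR.
Proof.
  subst alpha.
  assert (Hal : 0 <= beta - delta) by lra.
  set (c := k / (2 * a * h0)).
  assert (Hc : 0 < c)
    by (apply Rdiv_lt_0_compat; repeat apply Rmult_lt_0_compat; lra).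
  assert (HR : forall z, positive_root_R a k gamma beta delta h0 uinf z <->
    front_equation a k gamma beta delta c uinf z)
    by (intros z; apply positive_root_R_front; assumption).
  assert (HD : forall z, positive_root_D a k gamma beta delta u0 z <->
    front_equation a k gamma beta delta 0 u0 z)
    by (intros z; apply positive_root_D_front; assumption).
  split.
  - destruct (front_equation_exists a k gamma beta delta c uinf) as [z Hz];
      try assumption; [lra|].
    exists z; split; [apply HR; exact Hz|]. intros z' Hz'; apply HR in Hz'.
    apply (front_equation_unique a k gamma beta delta c uinf); try assumption; lra.
  - intros xiR HxiR Hrel; apply HR in HxiR.
    pose proof (proj1 HxiR) as Hxi.
    pose proof (kummer_Q_pos (beta - delta) xiR Hal Hxi) as HQ.
    pose proof (robin_denominator_pos c (beta - delta) xiR ltac:(lra) Hal Hxi) as Hden.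
    (* The parameter relation becomes equality of the two fluxes: by Kummer's transformation the
       Gaussian cancels between numerator and denominator. *)
    assert (Hu0 : u0 / kummer_Q (beta - delta) xiR
                  = uinf / robin_denominator c (beta - delta) xiR).
    { rewrite Rmult_assoc in Hrel.
      fold (kummer_A (beta - delta) xiR) (kummer_B (beta - delta) xiR) in Hrel.
      rewrite kummer_A_transform, kummer_B_transform in Hrel by lra.
      fold (kummer_P (beta - delta) xiR) (kummer_Q (beta - delta) xiR) in Hrel.
      pose proof (exp_pos (- xiR ^ 2)).
      unfold robin_denominator in *; rewrite Hrel; field.
      repeat split; try lra.
      replace (_ + _) with (exp (- xiR ^ 2) *
        (c * kummer_P (beta - delta) xiR + kummer_Q (beta - delta) xiR)) by ring.
      apply Rgt_not_eq, Rmult_lt_0_compat; lra. }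
    (* Equal fluxes give the same Stefan condition, so [xiR] solves the Dirichlet equation too. *)
    assert (HxiD : front_equation a k gamma beta delta 0 u0 xiR).
    { split; [exact Hxi|]. rewrite robin_denominator_0.
      destruct HxiR as [_ <-].
      transitivity (k / (2 * a) * (u0 / kummer_Q (beta - delta) xiR)); [field; lra|].
      rewrite Hu0; field; lra. }
    assert (Hiff : forall u s,
      similarity_solution (problem_R a k gamma beta delta h0 uinf) a (beta - delta) u s
      <-> similarity_solution (problem_D a k gamma beta delta u0) a (beta - delta) u s).
    { intros u s.
      rewrite (similarity_solution_R_profile a k gamma h0 uinf beta delta xiR),
        (similarity_solution_D_profile a k gamma u0 beta delta xiR) by assumption.
      fold c; replace (- uinf / robin_denominator c (beta - delta) xiR)
        with (- u0 / kummer_Q (beta - delta) xiR); [reflexivity|].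
      rewrite !Rdiv_opp_l, Hu0; reflexivity. }
    split; [exact Hiff|split].
    (* Existence and uniqueness for the Robin problem are transferred from the Dirichlet problem
       through [Hiff]. *)
    + destruct (unique_similarity_solution_D a k gamma u0 beta delta xiR)
        as (u & s & Hsol & Huniq); try assumption.
      exists u, s; split; [|split; assumption].
      split; [apply Hiff; exact Hsol|].
      intros u' s' H; apply Huniq, Hiff, H.
    + split; [apply HD; exact HxiD|].
      intros z Hz; apply HD in Hz.
      apply (front_equation_unique a k gamma beta delta 0 u0); try assumption; lra.
Qed.
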